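(* Let $n\ge1$, $k\in\{0,\dots,n\}$, $\ell\in\mathbb{Z}$, and $\mathfrak o$ a compact discrete valuation ring with residue field of cardinality $q$. Then $$\Phi^{\mathsf C}_{n,k,\ell}(q)=\psi_{n,\ell,\mathfrak o}\big(\Omega_{n,\mathfrak o}(T_{n,k,\mathfrak o})\big).$$
   Context: $\binom{a}{b}_Y=\prod_{i=1}^b\frac{1-Y^{a-i+1}}{1-Y^i}$. $\Delta_{n,k}(Y)=\prod_{i=1}^{n-k}(1+Y^{k+i})$ if $k=0$ and $\Delta_{n,k}(Y)=\prod_{i=1}^{n-k}(1+Y^{k+i})\cdot Y^{\binom{n-k+1}{2}}\binom{n}{k}_Y$ if $k>0$. $\Phi^{\mathsf C}_{n,0,\ell}(Y)=(Y^\ell+Y^n)\prod_{i=1}^{n-1}(1+Y^i)$ and, for $k\in[n]$, $\Phi^{\mathsf C}_{n,k,\ell}(Y)=\frac{\Delta_{n,k}(Y)}{Y^{2n}-1}\big(Y^{2\ell}-Y^{2\ell-n+k}+Y^{\ell+n+k}-2Y^\ell+Y^{\ell-n+k}+Y^{2n}-Y^{n+k}\big)$. Let $\mathfrak p$ be the maximal ideal of $\mathfrak o$. For a finite-index submodule $\Lambda\le\mathfrak o^n$ let $\varpi_i:\mathfrak o^n\to\mathfrak o^i$ be projection to the first $i$ coordinates and $\delta_i(\Lambda)=\log_q|\mathfrak o^i:\varpi_i(\Lambda)|-\log_q|\mathfrak o^{i-1}:\varpi_{i-1}(\Lambda)|$ ($i\in[n]$). For $a,b\ge0$, $\mathcal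 L_{a,b}(\mathfrak o^n)$ is the set of $\Lambda\le\mathfrak o^n$ with $\mathfrak o^n/\Lambda\cong(\mathfrak o/\mathfrak p)^a\oplus(\mathfrak o/\mathfrak p^2)^b$, $\omega_{a,b}=\sum_{\Lambda\in\mathcal L_{a,b}(\mathfrak o^n)}\prod_{i=1}^n(x_iq^{-i})^{\delta_i(\Lambda)}$, and $\mathrm{Sym}_{a,r}(\mathbb F_q)$ is the set of symmetric $a\times a$ matrices of rank $r$ over $\mathbb F_q$. $T_{n,k,\mathfrak o}$ denotes the generator of the symplectic Hecke ring of $(\mathrm{GSp}_{2n}(K)\cap\mathrm{Mat}_{2n}(\mathfrak o),\mathrm{GSp}_{2n}(\mathfrak o))$ given by the double coset of $\mathrm{diag}(1^{(n)},\pi^{(n)})$ ($k=0$) or $\mathrm{diag}(1^{(n-k)},\pi^{(k)},(\pi^2)^{(n-k)},\pi^{(k)})$ ($k\ge1$), and the normalized Satake map satisfies $\Omega_{n,\mathfrak o}(T_{n,0,\mathfrak o})=x_0\prod_{i=1}^n(1+x_i)$ and $\Omega_{n,\mathfrak o}(T_{n,k,\mathfrak o})=x_0^2\sum_{a=k}^n\sum_{b=0}^{n-a}q^{b(a+b+1)}\omega_{a,b}\,\#\mathrm{Sym}_{a,a-k}(\mathbb F_q)$ for $k\in[n]$. $\psi_{n,\ell,\mathfrak o}:\mathbb{Q}[x_0,\dots,x_n]\to\mathbb{Q}$ is the ring homomorphism $x_0\mapsto q^\ell$, $x_i\mapsto q^i$ ($i\in[n-1]$), $x_n\mapsto q^{n-\ell}$.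 *)

(* Defs.v *)
From HB Require Import structures.
From mathcomp Require Import all_boot all_order all_algebra.
From mathcomp Require Import finmap boolp classical_sets functions cardinality fsbigop.
From mathcomp Require Import mpoly.

Set Implicit Arguments.
Unset Strict Implicit.
Unset Printing Implicit Defensive.

Import Order.TTheory GRing.Theory Num.Theory.

Local Open Scope classical_set_scope.
Local Open Scope ring_scope.

Section DVR.
Variable o : idomainType.

Definition ideal (I : set o) : Prop :=
  [/\ I 0, (forall x y, I x -> I y -> I (x + y)) & (forall a x, I x -> I (a * x))].

Definition max_ideal : set o := [set x | x \isn't a GRing.unit].

(* a local principal ideal domain that is not a field *)
Definition is_dvr : Prop :=
  [/\ forall I, ideal I -> exists a, I = range ( *%R a),
      ideal max_ideal
    & exists2 x, max_ideal x & x != 0].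

(* [pideal pi m] is the m-th power of the maximal ideal once [pi] is a
   uniformizer *)
Definition pideal (pi : o) (m : nat) : set o := range ( *%R (pi ^+ m)).

Definition uniformizer (pi : o) : Prop := max_ideal = pideal pi 1.

Lemma uniformizer_neq0 (pi : o) : is_dvr -> uniformizer pi -> pi != 0.
Proof.
move=> [_ _ [x + x0]] Epi; rewrite Epi => -[y _ E].
by apply: contra_neq x0 => pi0; rewrite -E pi0 expr1 mul0r.
Qed.

Definition adic_open (pi : o) (U : set o) : Prop :=
  forall x, U x -> exists m, forall y, pideal pi m (y - x) -> U y.

Definition adic_compact (pi : o) : Prop :=
  forall C : set (set o), C `<=` adic_open pi -> \bigcup_(U in C) U = setT ->
  exists2 C' : set (set o), finite_set C' /\ C' `<=` C
                          & \bigcup_(U in C') U = setT.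

(* [red] presents [F] as the residue field *)
Definition residue_map (F : fieldType) (red : {rmorphism o -> F}) : Prop :=
  (forall y, exists x, red x = y) /\ (forall x, red x = 0 <-> max_ideal x).

End DVR.

Definition sympl (R : pzRingType) (n : nat) : 'M[R]_(n + n) :=
  block_mx 0 1%:M (- 1%:M) 0.

Definition GSp (R : comUnitRingType) (n : nat) : set 'M[R]_(n + n) :=
  [set g | exists2 mu : R, mu \is a GRing.unit
                         & g^T *m sympl R n *m g = mu *: sympl R n].

Section GSpTheory.
Variables (R : comUnitRingType) (n : nat).
Local Notation J := (sympl R n).
Local Notation GSp := (@GSp R n).

Lemma symplN : J *m J = - 1%:M.
Proof.
rewrite /sympl mulmx_block !mul0mx !mulmx0 !mul1mx !mulmx1 !add0r !addr0.
by rewrite -[1%:M in RHS]/(1%:M) (@scalar_mx_block _ n n) opp_block_mx !oppr0.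
Qed.

Lemma GSp_inv g mu : mu \is a GRing.unit -> g^T *m J *m g = mu *: J ->
  (- mu^-1 *: (J *m g^T *m J)) *m g = 1%:M.
Proof.
move=> mu_u E; rewrite -scalemxAl -!mulmxA (mulmxA g^T) E -scalemxAr symplN.
by rewrite scalerA mulNr mulVr // scaleN1r opprK.
Qed.

Lemma GSp_unit g : GSp g -> g \in unitmx.
Proof. by case=> mu mu_u /(GSp_inv mu_u)/mulmx1_unit[]. Qed.

Lemma GSp1 : GSp 1%:M.
Proof. by exists 1; rewrite ?unitr1 // trmx1 mul1mx mulmx1 scale1r. Qed.

Lemma GSpM g h : GSp g -> GSp h -> GSp (g *m h).
Proof.
move=> [mu mu_u Eg] [nu nu_u Eh]; exists (mu * nu); first by rewrite unitrM mu_u.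
rewrite trmx_mul -!mulmxA (mulmxA J) (mulmxA g^T) (mulmxA g^T) Eg.
by rewrite -scalemxAl -scalemxAr mulmxA Eh scalerA.
Qed.

Lemma GSpV g : GSp g -> GSp (invmx g).
Proof.
move=> Gg; have gu := GSp_unit Gg; case: Gg => mu mu_u E.
exists mu^-1; first by rewrite unitrV.
have E2 : (invmx g)^T *m (g^T *m J *m g) *m invmx g = J.
  by rewrite !mulmxA -trmx_mul mulmxV // trmx1 mul1mx mulmxK.
by rewrite -[in RHS]E2 E -scalemxAr -scalemxAl scalerA mulVr ?scale1r.
Qed.

End GSpTheory.

Section Convolution.
Variables (K : fieldType) (m : nat).
Local Notation M := 'M[K]_m.
Variables (G Gam Del : set M).

Definition lcoset (g : M) : set M := [set g *m c | c in Gam].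
Definition lcosets : set (set M) := [set lcoset g | g in G].
Definition dcoset (g : M) : set M :=
  [set x | exists a b, [/\ Gam a, Gam b & x = a *m g *m b]].

(* Bi-invariant integer-valued functions supported on finitely many cosets
   contained in Del *)
Definition hecke_fun (f : M -> int) : Prop :=
  [/\ forall x, f x != 0 -> Del x,
      forall a b x, Gam a -> Gam b -> f (a *m x *m b) = f x
    & finite_set [set lcoset x | x in [set x | f x != 0]]].

(* (f * g)(x) is the sum of f(y) g(y^-1 x) over the cosets C = y Gam contained
   in G; the summand does not depend on the chosen element y of C *)
Definition conv (f g : M -> int) (x : M) : int :=
  \sum_(C \in lcosets) f (xget 0 C) * g (invmx (xget 0 C) *m x).

Definition conv1 (x : M) : int := `[< Gam x >]%:R.

Hypothesis G_unit : forall g, G g -> g \in unitmx.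
Hypothesis GM : forall g h, G g -> G h -> G (g *m h).
Hypothesis GV : forall g, G g -> G (invmx g).
Hypothesis DelG : Del `<=` G.
Hypothesis DelM : forall g h, Del g -> Del h -> Del (g *m h).
Hypothesis GamDel : Gam `<=` Del.
Hypothesis Gam1 : Gam 1%:M.
Hypothesis GamM : forall g h, Gam g -> Gam h -> Gam (g *m h).
Hypothesis GamV : forall g, Gam g -> Gam (invmx g).

Let GamG : Gam `<=` G. Proof. by move=> x /GamDel/DelG. Qed.

Lemma lcoset_refl x : lcoset x x.
Proof. by exists 1%:M; rewrite ?mulmx1. Qed.

Lemma lcoset_id x c : Gam c -> lcoset (x *m c) = lcoset x.
Proof.
move=> Gc; have cu := G_unit (GamG Gc); apply/seteqP; split=> y [d Gd <-].
  by exists (c *m d); rewrite ?mulmxA //; apply: GamM.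
exists (invmx c *m d); first by apply: GamM => //; apply: GamV.
by rewrite -mulmxA mulKVmx.
Qed.

Lemma xget_lcoset x : exists2 c, Gam c & xget 0 (lcoset x) = x *m c.
Proof.
have : lcoset x (xget 0 (lcoset x)) by apply: xgetPex; exists x; apply: lcoset_refl.
by case=> c Gc <-; exists c.
Qed.

Lemma invmxM (x y : M) : x \in unitmx -> y \in unitmx ->
  invmx (x *m y) = invmx y *m invmx x.
Proof.
move=> xu yu; apply: (can_inj (mulKmx (_ : x *m y \in unitmx))).
  by rewrite unitmx_mul xu.
by rewrite mulmxV ?unitmx_mul ?xu // -mulmxA mulKVmx // mulmxV.
Qed.

Definition rinv (F : M -> int) := forall x c, Gam c -> F (x *m c) = F x.

Lemma rinv_xget F x : rinv F -> F (xget 0 (lcoset x)) = F x.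
Proof. by move=> Fi; have [c Gc ->] := xget_lcoset x; rewrite Fi. Qed.

Definition csum (F : M -> int) : int := \sum_(C \in lcosets) F (xget 0 C).

Lemma csum_trans F z : G z -> rinv F -> csum F = csum (fun y => F (z *m y)).
Proof.
move=> Gz Fi; have zu := G_unit Gz; rewrite /csum.
pose h (C : set M) := [set z *m c | c in C].
have hE g : h (lcoset g) = lcoset (z *m g).
  apply/seteqP; split=> [y [_ [c Gc <-] <-]|y [c Gc <-]].
    by exists c; rewrite ?mulmxA.
  by exists (g *m c); rewrite ?mulmxA //; exists c.
rewrite (@reindex_fsbig _ _ _ _ _ h lcosets lcosets).
  apply: eq_fsbigr => C; rewrite inE => -[g Gg <-].
  rewrite hE rinv_xget // (rinv_xget (F := fun y => F (z *m y))) //.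
  by move=> x c Gc; rewrite mulmxA Fi.
split=> [_ [g Gg <-]||_ [g Gg <-]].
- by exists (z *m g); rewrite ?hE //; apply: GM.
- move=> C D _ _ E; apply/seteqP; split=> y Cy.
    have : h C (z *m y) by exists y.
    by rewrite E => -[y' Dy' /(can_inj (mulKmx zu)) <-].
  have : h D (z *m y) by exists y.
  by rewrite -E => -[y' Dy' /(can_inj (mulKmx zu)) <-].
- exists (lcoset (invmx z *m g)); last by rewrite hE mulKVmx.
  by exists (invmx z *m g) => //; apply: GM => //; apply: GV.
Qed.

Section Functions.
Variables (f g : M -> int).
Hypotheses (Hf : hecke_fun f) (Hg : hecke_fun g).

Lemma hecke_rinv : rinv f.
Proof. by move=> x c Gc; case: Hf => _ /(_ 1%:M c x Gam1 Gc); rewrite mul1mx. Qed.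

Lemma hecke_linv c x : Gam c -> f (c *m x) = f x.
Proof. by move=> Gc; case: Hf => _ /(_ c 1%:M x Gc Gam1); rewrite mulmx1. Qed.

End Functions.

Definition csupp (f : M -> int) : set (set M) :=
  [set lcoset x | x in [set x | f x != 0]].

Lemma csupp_lcosets f : hecke_fun f -> csupp f `<=` lcosets.
Proof. by case=> fD _ _ _ [x /fD/DelG Gx <-]; exists x. Qed.

Definition cprod (f g : M -> int) : set (set M) :=
  [set lcoset (xget 0 C *m xget 0 D) | C in csupp f & D in csupp g].

Lemma cprod_finite f g : hecke_fun f -> hecke_fun g -> finite_set (cprod f g).
Proof. by move=> [_ _ ff] [_ _ fg]; apply: finite_image2. Qed.

Lemma cprod_lcosets f g : hecke_fun f -> hecke_fun g -> cprod f g `<=` lcosets.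
Proof.
move=> [fD fi _] [gD gi _] _ [_ [x fx <-] [_ [y gy <-] <-]].
have [c Gc ->] := xget_lcoset x; have [d Gd ->] := xget_lcoset y.
exists (x *m c *m (y *m d)) => //.
by do 2?apply: GM; [apply/DelG/fD|apply: GamG|apply/DelG/gD|apply: GamG].
Qed.

Lemma cprodP f g x y : hecke_fun f -> hecke_fun g -> f y != 0 -> G x ->
  g (invmx y *m x) != 0 -> cprod f g (lcoset x).
Proof.
move=> Hf Hg fy Gx gx; have yu : y \in unitmx.
  by apply: G_unit; apply: DelG; case: Hf => + _ _; apply.
have [c Gc Ec] := xget_lcoset y.
have cu := G_unit (GamG Gc).
exists (lcoset y); first by exists y.
exists (lcoset (invmx c *m (invmx y *m x))).
  exists (invmx c *m (invmx y *m x)) => //=.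
  by rewrite (hecke_linv Hg) //; apply: GamV.
rewrite Ec; have [d Gd ->] := xget_lcoset (invmx c *m (invmx y *m x)).
by rewrite !mulmxA lcoset_id // mulmxK // mulmxV // mul1mx.
Qed.

Lemma conv_rinv f g x : hecke_fun f -> hecke_fun g ->
  rinv (fun y => f y * g (invmx y *m x)).
Proof.
move=> Hf Hg y c Gc; rewrite (hecke_rinv Hf) //; have [-> | fy] := eqVneq (f y) 0.
  by rewrite !mul0r.
have yu : y \in unitmx by apply: G_unit; apply: DelG; case: Hf => + _ _; apply.
rewrite invmxM ?(G_unit (GamG Gc)) // -mulmxA (hecke_linv Hg) //.
exact: GamV.
Qed.

Lemma conv_neq0 f g x : conv f g x != 0 ->
  exists2 y, G y & f (xget 0 (lcoset y)) != 0 /\ g (invmx (xget 0 (lcoset y)) *m x) != 0.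
Proof.
move=> H; apply: contrapT => N; case/eqP: H; apply: fsbig1 => _ [y Gy <-].
apply/eqP; rewrite mulf_eq0; apply/negPn/negP; rewrite negb_or => /andP[a b].
by apply: N; exists y.
Qed.

Lemma conv_hecke f g : hecke_fun f -> hecke_fun g -> hecke_fun (conv f g).
Proof.
move=> Hf Hg; have [fD _ _] := Hf; have [gD _ _] := Hg.
have D x : conv f g x != 0 -> exists2 y, f y != 0 & g (invmx y *m x) != 0.
  by move=> /conv_neq0[y _ [a b]]; exists (xget 0 (lcoset y)).
have D1 x : conv f g x != 0 -> Del x.
  move=> /D[y fy gy]; have yu := G_unit (DelG (fD _ fy)).
  by rewrite -(mulKVmx yu x); apply: DelM; [apply: fD|apply: gD].
split=> //.
- move=> a b x Ga Gb; have au := G_unit (GamG Ga).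
  transitivity (csum (fun y => f y * g (invmx y *m (a *m x)))).
    apply: eq_fsbigr => C _; congr (_ * _).
    by rewrite (mulmxA (invmx _)) (hecke_rinv Hg).
  rewrite (@csum_trans _ a); [|exact: GamG|exact: conv_rinv].
  apply: eq_fsbigr => C; rewrite inE => -[y Gy <-].
  rewrite (hecke_linv Hf) //; congr (_ * g _).
  have [c Gc ->] := xget_lcoset y.
  have u : y *m c \in unitmx by rewrite unitmx_mul !G_unit //; apply: GamG.
  by rewrite invmxM // -mulmxA mulKmx.
- apply: sub_finite_set (cprod_finite Hf Hg) => _ [x /= fgx <-].
  have [y fy gy] := D _ fgx; apply: cprodP fy _ gy => //.
  exact/DelG/D1.
Qed.

Lemma convA f g h : hecke_fun f -> hecke_fun g -> hecke_fun h ->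
  conv f (conv g h) = conv (conv f g) h.
Proof.
move=> Hf Hg Hh; apply/funext => x; have Hgh := conv_hecke Hg Hh.
have [fD _ ff] := Hf.
transitivity (\sum_(C \in csupp f) \sum_(D \in cprod f g)
  f (xget 0 C) * g (invmx (xget 0 C) *m xget 0 D) * h (invmx (xget 0 D) *m x)).
  rewrite /conv -(@fsbig_widen _ _ _ _ (csupp f)); last first.
  - move=> _ [[y Gy <-]] N /=; rewrite (rinv_xget _ (hecke_rinv Hf)).
    suff -> : f y = 0 by rewrite mul0r.
    by apply/eqP/negPn/negP => fy; apply: N; exists y.
  - exact: csupp_lcosets.
  apply: eq_fsbigr => _ /[!inE] -[y /= fy <-].
  have Gy := DelG (fD _ fy).
  set z := xget 0 (lcoset y).
  have Gz : G z.
    by rewrite /z; have [c Gc ->] := xget_lcoset y; apply: GM => //; apply: GamG.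
  have zu := G_unit Gz.
  have fz : f z != 0 by rewrite /z (rinv_xget _ (hecke_rinv Hf)).
  rewrite -/(csum (fun d => g d * h (invmx d *m (invmx z *m x)))).
  rewrite (@csum_trans _ (invmx z)); [|exact: GV|exact: conv_rinv].
  rewrite /csum mulr_fsumr (@fsbig_widen _ _ _ _ (cprod f g) lcosets).
  - apply: eq_fsbigr => _ /[!inE] -[d Gd <-]; rewrite mulrA; congr (_ * h _).
    have [c Gc ->] := xget_lcoset d.
    have u : d *m c \in unitmx by rewrite unitmx_mul !G_unit //; apply: GamG.
    by rewrite invmxM ?unitmx_inv // invmxK -!mulmxA mulKVmx.
  - exact: cprod_lcosets.
  - move=> _ [[d Gd <-]] N /=.
    suff -> : g (invmx z *m xget 0 (lcoset d)) = 0 by rewrite mulr0 mul0r.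
    have [c Gc ->] := xget_lcoset d; rewrite mulmxA (hecke_rinv Hg) //.
    by apply/eqP/negPn/negP => gd; apply: N; apply: cprodP gd.
rewrite exchange_fsbig //; last exact: cprod_finite.
rewrite [RHS](_ : _ = \sum_(D \in cprod f g)
    conv f g (xget 0 D) * h (invmx (xget 0 D) *m x)); last first.
  symmetry; apply: fsbig_widen; first exact: cprod_lcosets.
  move=> _ [[d Gd <-]] N /=; have [c Gc E] := xget_lcoset d.
  suff -> : conv f g (xget 0 (lcoset d)) = 0 by rewrite mul0r.
  apply/eqP/negPn/negP => /conv_neq0[y Gy [fy gy]]; apply: N.
  move: gy; rewrite E mulmxA (hecke_rinv Hg) // => gy.
  exact: cprodP gy.
apply: eq_fsbigr => D _; rewrite /conv mulr_fsuml; apply: fsbig_widen.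
  exact: csupp_lcosets.
move=> _ [[y Gy <-]] N /=; rewrite (rinv_xget _ (hecke_rinv Hf)).
suff -> : f y = 0 by rewrite !mul0r.
by apply/eqP/negPn/negP => fy; apply: N; exists y.
Qed.

Lemma indic_neq0 (A : set M) x : (`[< A x >]%:R : int) != 0 -> A x.
Proof. by case: asboolP. Qed.

Lemma conv1_hecke : hecke_fun conv1.
Proof.
split=> [x /indic_neq0/GamDel //|a b x Ga Gb|].
- rewrite /conv1; congr (nat_of_bool _)%:R; apply: asbool_equiv_eq; split.
    move=> H; have au := G_unit (GamG Ga); have bu := G_unit (GamG Gb).
    rewrite -(mulKmx au x) -[_ *m _](mulmxK bu) -(mulmxA (invmx a)).
    by apply: GamM; [apply: GamM => //; apply: GamV|apply: GamV].
  by move=> Gx; apply: GamM => //; apply: GamM.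
- apply: (sub_finite_set (B := [set lcoset 1%:M])) => // _ [x /indic_neq0 Gx <-] /=.
  by rewrite -(mul1mx x) lcoset_id.
Qed.

Lemma conv1f f : hecke_fun f -> conv conv1 f = f.
Proof.
move=> Hf; apply/funext => x; rewrite /conv.
rewrite -(@fsbig_widen _ _ _ _ [set lcoset 1%:M]).
- rewrite fsbig_set1; have [c Gc ->] := xget_lcoset 1%:M; rewrite mul1mx /conv1.
  by rewrite asboolT // mul1r (hecke_linv Hf) //; apply: GamV.
- by move=> _ ->; exists 1%:M => //; apply: GamG.
- move=> _ [[y Gy <-]] N /=; have [c Gc ->] := xget_lcoset y.
  rewrite /conv1 asboolF ?mul0r // => H; apply: N.
  by rewrite /= -(lcoset_id y Gc) -(mul1mx (y *m c)) lcoset_id.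
Qed.

Lemma convf1 f : hecke_fun f -> conv f conv1 = f.
Proof.
move=> Hf; apply/funext => x.
have [Gx|NGx] := pselect (G x); last first.
  transitivity (0 : int).
    apply/eqP/negPn/negP => /conv_neq0[y Gy [_ /indic_neq0/GamG H]]; apply: NGx.
    have [c Gc E] := xget_lcoset y; rewrite E in H.
    have Gyc : G (y *m c) by apply: GM => //; apply: GamG.
    by rewrite -(mulKVmx (G_unit Gyc) x); apply: GM.
  apply/esym/eqP/negPn/negP => fx; apply: NGx.
  by apply: DelG; case: Hf => + _ _; apply.
rewrite /conv -(@fsbig_widen _ _ _ _ [set lcoset x]).
- rewrite fsbig_set1 (rinv_xget _ (hecke_rinv Hf)).
  have [c Gc ->] := xget_lcoset x; have cu := G_unit (GamG Gc).
  have xu := G_unit Gx; rewrite (invmxM xu cu) mulmxKV // /conv1 asboolT ?mulr1 //.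
  exact: GamV.
- by move=> _ ->; exists x.
- move=> _ [[y Gy <-]] N /=; have [c Gc ->] := xget_lcoset y.
  have Gyc : G (y *m c) by apply: GM => //; apply: GamG.
  rewrite /conv1 asboolF ?mulr0 // => H; apply: N => /=.
  by rewrite -(lcoset_id y Gc) -(lcoset_id (y *m c) H) (mulKVmx (G_unit Gyc)).
Qed.

Lemma hecke_fun0 : hecke_fun 0.
Proof.
split=> [x|//|]; first by rewrite eqxx.
by apply: (sub_finite_set (B := set0)) => // C [x] /eqP[].
Qed.

Lemma hecke_funB f g : hecke_fun f -> hecke_fun g -> hecke_fun (f - g).
Proof.
move=> [fD fi ff] [gD gi fg].
have H x : (f - g) x != 0 -> f x != 0 \/ g x != 0.
  rewrite -[(f - g) x]/(f x - g x); have [->|] := eqVneq (f x) 0; last by left.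
  by rewrite sub0r oppr_eq0; right.
split=> [x /H[/fD|/gD]//|a b x Ga Gb|].
  by rewrite -[LHS]/(f _ - g _) fi // gi.
have : finite_set (csupp f `|` csupp g) by rewrite finite_setU.
by apply: sub_finite_set => _ [x /H[]fx <-]; [left|right]; exists x.
Qed.

Lemma convDl f1 f2 g : hecke_fun f1 -> hecke_fun f2 -> hecke_fun g ->
  conv (f1 + f2) g = conv f1 g + conv f2 g.
Proof.
move=> Hf1 Hf2 Hg; apply/funext => x; rewrite -[RHS]/(conv f1 g x + conv f2 g x).
have [D1 _ F1] := Hf1; have [D2 _ F2] := Hf2.
pose S := csupp f1 `|` csupp f2.
have SL : S `<=` lcosets by rewrite subUset; split; apply: csupp_lcosets.
have fS : finite_set S by rewrite finite_setU.
have W (F : M -> int) : (forall y, F y != 0 -> f1 y != 0 \/ f2 y != 0) -> rinv F ->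
    conv F g x = \sum_(C \in S) F (xget 0 C) * g (invmx (xget 0 C) *m x).
  move=> HF Fi; rewrite /conv -(@fsbig_widen _ _ _ _ S) // => _ [[y Gy <-]] N /=.
  rewrite rinv_xget //; suff -> : F y = 0 by rewrite mul0r.
  apply/eqP/negPn/negP => /HF[]fy; apply: N; [left|right]; exact: (ex_intro2 _ _ y).
have i1 := hecke_rinv Hf1; have i2 := hecke_rinv Hf2.
rewrite !W //; try by [left|right].
- rewrite -fsbig_split //; apply: eq_fsbigr => C _.
  exact: mulrDl.
- move=> y; rewrite -[(f1 + f2) y]/(f1 y + f2 y).
  by have [->|] := eqVneq (f1 y) 0; [rewrite add0r; right|left].
- by move=> y c Gc; rewrite -[LHS]/(f1 _ + f2 _) i1 // i2.
Qed.

Lemma convDr f g1 g2 : hecke_fun f -> hecke_fun g1 -> hecke_fun g2 ->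
  conv f (g1 + g2) = conv f g1 + conv f g2.
Proof.
move=> Hf Hg1 Hg2; apply/funext => x; rewrite -[RHS]/(conv f g1 x + conv f g2 x).
have [_ _ ff] := Hf; have fi := hecke_rinv Hf.
have W (g : M -> int) :
    conv f g x = \sum_(C \in csupp f) f (xget 0 C) * g (invmx (xget 0 C) *m x).
  rewrite /conv -(@fsbig_widen _ _ _ _ (csupp f)) //; first exact: csupp_lcosets.
  move=> _ [[y Gy <-]] N /=.
  rewrite rinv_xget //; suff -> : f y = 0 by rewrite mul0r.
  by apply/eqP/negPn/negP => fy; apply: N; exists y.
rewrite !W -fsbig_split //; apply: eq_fsbigr => C _.
exact: mulrDr.
Qed.

End Convolution.

Section Hecke.
Variables (o : idomainType) (n : nat).
Local Notation K := {fraction o}.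
Local Notation M := 'M[K]_(n + n).
Local Notation incl := (map_mx (@tofrac o)).

(* GSp_2n(o) and GSp_2n(K) /\ Mat_2n(o), inside Mat_2n(K) *)
Definition Gamma_o : set M := [set incl g | g in @GSp o n].
Definition Delta_o : set M := @GSp K n `&` range incl.

Lemma incl_GSp (g : 'M[o]_(n + n)) : GSp g -> GSp (incl g).
Proof.
move=> [mu mu_u E]; exists (tofrac mu); first by rewrite rmorph_unit.
have JE : sympl K n = incl (sympl o n).
  by rewrite /sympl map_block_mx map_mxN !map_mx0 map_mx1.
by rewrite JE map_trmx -!map_mxM E map_mxZ.
Qed.

Lemma incl_unit (g : 'M[o]_(n + n)) : GSp g -> invmx (incl g) = incl (invmx g).
Proof.
move=> Gg; have u := GSp_unit (incl_GSp Gg).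
apply: (can_inj (mulKmx u)).
by rewrite mulmxV // -map_mxM mulmxV ?map_mx1 // GSp_unit.
Qed.

Lemma Delta_GSp : Delta_o `<=` @GSp K n. Proof. by move=> x []. Qed.

Lemma Delta_M g h : Delta_o g -> Delta_o h -> Delta_o (g *m h).
Proof.
move=> [Gg [a _ Ea]] [Gh [b _ Eb]]; split; first exact: GSpM.
by exists (a *m b); rewrite // map_mxM Ea Eb.
Qed.

Lemma Gamma_Delta : Gamma_o `<=` Delta_o.
Proof. by move=> _ [g Gg <-]; split; [exact: incl_GSp|exists g]. Qed.

Lemma Gamma_1 : Gamma_o 1%:M.
Proof. by exists 1%:M; [exact: GSp1|rewrite map_mx1]. Qed.

Lemma Gamma_M g h : Gamma_o g -> Gamma_o h -> Gamma_o (g *m h).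
Proof.
by move=> [a Ga <-] [b Gb <-]; exists (a *m b); [exact: GSpM|rewrite map_mxM].
Qed.

Lemma Gamma_V g : Gamma_o g -> Gamma_o (invmx g).
Proof. by move=> [a Ga <-]; exists (invmx a); [exact: GSpV|rewrite incl_unit]. Qed.

Definition is_hecke : {pred M -> int} :=
  fun f => `[< hecke_fun Gamma_o Delta_o f >].

Lemma is_heckeP f : reflect (hecke_fun Gamma_o Delta_o f) (f \in is_hecke).
Proof. exact: asboolP. Qed.

Lemma is_hecke_zmod : zmod_closed is_hecke.
Proof.
split; first by apply/is_heckeP; apply: hecke_fun0.
by move=> f g /is_heckeP Hf /is_heckeP Hg; apply/is_heckeP; apply: hecke_funB.
Qed.
HB.instance Definition _ := GRing.isZmodClosed.Build _ is_hecke is_hecke_zmod.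

Record hecke := Hecke { hecke_val :> M -> int; hecke_valP : hecke_val \in is_hecke }.
HB.instance Definition _ := [isSub for hecke_val].
HB.instance Definition _ := [Choice of hecke by <:].
HB.instance Definition _ := [SubChoice_isSubZmodule of hecke by <:].

Lemma heckeP (f : hecke) : hecke_fun Gamma_o Delta_o f.
Proof. exact/is_heckeP/hecke_valP. Qed.

Fact hecke1_subproof : conv1 Gamma_o \in is_hecke.
Proof.
apply/is_heckeP; apply: (@conv1_hecke _ _ (@GSp K n));
  by [exact: GSp_unit|exact: Delta_GSp|exact: Gamma_Delta|exact: Gamma_1
     |exact: Gamma_M|exact: Gamma_V].
Qed.

Fact heckeM_subproof (f g : hecke) : conv (@GSp K n) Gamma_o f g \in is_hecke.
Proof.
apply/is_heckeP; apply: conv_hecke (heckeP f) (heckeP g);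
  by [exact: GSp_unit|exact: GSpM|exact: GSpV|exact: Delta_GSp|exact: Delta_M
     |exact: Gamma_Delta|exact: Gamma_1|exact: Gamma_M|exact: Gamma_V].
Qed.

Definition hecke1 : hecke := Hecke hecke1_subproof.
Definition heckeM (f g : hecke) : hecke := Hecke (heckeM_subproof f g).

Lemma heckeMA : associative heckeM.
Proof.
move=> f g h; apply: val_inj; apply: convA (heckeP f) (heckeP g) (heckeP h);
  by [exact: GSp_unit|exact: GSpM|exact: GSpV|exact: Delta_GSp|exact: Delta_M
     |exact: Gamma_Delta|exact: Gamma_1|exact: Gamma_M|exact: Gamma_V].
Qed.

Lemma hecke1M : left_id hecke1 heckeM.
Proof.
move=> f; apply: val_inj; apply: conv1f (heckeP f);
  by [exact: GSp_unit|exact: GSpM|exact: GSpV|exact: Delta_GSp|exact: Delta_M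
     |exact: Gamma_Delta|exact: Gamma_1|exact: Gamma_M|exact: Gamma_V].
Qed.

Lemma heckeM1 : right_id hecke1 heckeM.
Proof.
move=> f; apply: val_inj; apply: convf1 (heckeP f);
  by [exact: GSp_unit|exact: GSpM|exact: GSpV|exact: Delta_GSp|exact: Delta_M
     |exact: Gamma_Delta|exact: Gamma_1|exact: Gamma_M|exact: Gamma_V].
Qed.

Lemma heckeMDl : left_distributive heckeM +%R.
Proof.
move=> f1 f2 g; apply: val_inj; apply: convDl (heckeP f1) (heckeP f2) (heckeP g);
  by [exact: GSp_unit|exact: GSpM|exact: GSpV|exact: Delta_GSp|exact: Delta_M
     |exact: Gamma_Delta|exact: Gamma_1|exact: Gamma_M|exact: Gamma_V].
Qed.

Lemma heckeMDr : right_distributive heckeM +%R.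
Proof.
move=> f g1 g2; apply: val_inj; apply: convDr (heckeP f) (heckeP g1) (heckeP g2);
  by [exact: GSp_unit|exact: GSpM|exact: GSpV|exact: Delta_GSp|exact: Delta_M
     |exact: Gamma_Delta|exact: Gamma_1|exact: Gamma_M|exact: Gamma_V].
Qed.

HB.instance Definition _ :=
  GRing.Zmodule_isPzRing.Build hecke heckeMA hecke1M heckeM1 heckeMDl heckeMDr.

Definition elt_fun (g : 'M[o]_(n + n)) (x : M) : int :=
  `[< dcoset Gamma_o (incl g) x >]%:R.

(* the double coset of g; the default 0 does not occur for the g considered
   below, see [hecke_TE] *)
Definition hecke_elt (g : 'M[o]_(n + n)) : hecke := insubd 0 (elt_fun g).

Section Finiteness.
Variables (F : finFieldType) (red : {rmorphism o -> F}) (pi : o).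
Hypotheses (red_res : residue_map red) (pi_unif : uniformizer pi) (pi_neq0 : pi != 0).

Lemma residues_finite d : exists s : seq o,
  forall x, exists2 t, t \in s & exists y, x - t = pi ^+ d * y.
Proof.
have [red_surj red_ker] := red_res.
have [sec secK] := choice red_surj.
elim: d => [|d [s IH]].
  by exists [:: 0] => x; exists 0; rewrite ?inE //; exists x; rewrite subr0 mul1r.
exists [seq t + pi ^+ d * sec a | t <- s, a <- enum F] => x.
have [t ts [y E]] := IH x.
have : max_ideal (y - sec (red y)).
  by apply/red_ker; rewrite rmorphB secK subrr.
rewrite pi_unif => -[z _]; rewrite expr1 => Ez.
exists (t + pi ^+ d * sec (red y)).
  by apply: allpairs_f; rewrite ?mem_enum.
by exists z; rewrite opprD addrA E -mulrBr -Ez exprSr mulrA.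
Qed.

Lemma elt_hecke g d : g^T *m sympl o n *m g = pi ^+ d *: sympl o n ->
  elt_fun g \in is_hecke.
Proof.
move=> Eg; have pid0 : pi ^+ d != 0 by rewrite expf_neq0.
have GK : GSp (incl g).
  exists (tofrac (pi ^+ d)); first by rewrite unitfE tofrac_eq0.
  have JE : sympl K n = incl (sympl o n).
    by rewrite /sympl map_block_mx map_mxN !map_mx0 map_mx1.
  by rewrite JE map_trmx -!map_mxM Eg map_mxZ.
have JJ := symplN o n.
have hg : (- (sympl o n *m g^T *m sympl o n)) *m g = (pi ^+ d)%:M.
  by rewrite mulNmx -!mulmxA (mulmxA g^T) Eg -scalemxAr JJ scalerN opprK scalemx1.
have DP : forall a b, Gamma_o a -> Gamma_o b -> Delta_o (a *m incl g *m b).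
  move=> a b Ga Gb; apply: Delta_M; last exact: Gamma_Delta.
  apply: Delta_M; first exact: Gamma_Delta.
  by split=> //; exists g.
apply/is_heckeP; split=> [x /indic_neq0[a [b [Ga Gb ->]]]|a b x Ga Gb|].
- exact: DP.
- congr (nat_of_bool _)%:R; apply: asbool_equiv_eq; split=> -[a' [b' [Ga' Gb' E]]].
    have au := GSp_unit (Delta_GSp (Gamma_Delta Ga)).
    have bu := GSp_unit (Delta_GSp (Gamma_Delta Gb)).
    exists (invmx a *m a'), (b' *m invmx b); split.
    + by apply: Gamma_M => //; apply: Gamma_V.
    + by apply: Gamma_M => //; apply: Gamma_V.
    + by rewrite -(mulKmx au x) -[a *m x](mulmxK bu) E !mulmxA.
  exists (a *m a'), (b' *m b); split; try exact: Gamma_M.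
  by rewrite E !mulmxA.
have [s sP] := residues_finite d.
have [key keyP] : exists key : o -> 'I_(size s).+1,
    forall x y, key x = key y -> exists z, x - y = pi ^+ d * z.
  have H x : exists i : 'I_(size s).+1, exists y, x - s`_i = pi ^+ d * y.
    have [t ts tE] := sP x; have lt : (index t s < (size s).+1)%N.
      by rewrite ltnS index_size.
    by exists (Ordinal lt); rewrite /= nth_index.
  have [key keyE] := choice H; exists key => x y E.
  have [z zE] := keyE x; have [w wE] := keyE y; exists (z - w).
  by rewrite mulrBr -zE -wE E opprB addrA subrK.
pose cs (a : 'M[o]_(n + n)) := lcoset Gamma_o (incl (a *m g)).
have csE a b : GSp a -> GSp b -> map_mx key a = map_mx key b -> cs a = cs b.
  move=> Ga Gb Eab.
  have [e eE] : exists e : 'M[o]_(n + n), b - a = pi ^+ d *: e.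
    have H (i j : 'I_(n + n)) : exists z, (b - a) i j = pi ^+ d * z.
      rewrite !mxE; apply: keyP.
      by have /matrixP/(_ i j) := Eab; rewrite !mxE.
    have [e eE] := choice (fun ij : 'I_(n + n) * 'I_(n + n) => H ij.1 ij.2).
    exists (\matrix_(i, j) e (i, j)); apply/matrixP => i j.
    by rewrite (eE (i, j)) !mxE.
  pose h := - (sympl o n *m g^T *m sympl o n).
  have gh : g *m h = (pi ^+ d)%:M.
    have gu := GSp_unit GK.
    have ghK : incl (g *m h) = incl ((pi ^+ d)%:M).
      rewrite map_mxM; apply: (can_inj (mulmxK gu)).
      by rewrite -mulmxA -map_mxM hg !map_scalar_mx scalar_mxC.
    apply/matrixP => i j; have /matrixP/(_ i j) := ghK.
    by rewrite [LHS]mxE [RHS]mxE => /eqP; rewrite tofrac_eq => /eqP.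
  pose c := 1%:M + h *m invmx a *m e *m g.
  have Ec : a *m g *m c = b *m g.
    rewrite mulmxDr mulmx1 !mulmxA -(mulmxA a) gh.
    rewrite mul_mx_scalar -scalemxAl mulmxV ?GSp_unit // -!scalemxAl mul1mx.
    by rewrite [pi ^+ d *: _]scalemxAl -eE mulmxBl addrC subrK.
  have Gc : GSp c.
    case: Ga => al al_u Ea; case: Gb => be be_u Eb.
    exists (al^-1 * be); first by rewrite unitrM unitrV al_u.
    have P (x y : 'M[o]_(n + n)) :
        (x *m y)^T *m sympl o n *m (x *m y) = y^T *m (x^T *m sympl o n *m x) *m y.
      by rewrite trmx_mul !mulmxA.
    have := P b g; rewrite Eb -Ec P P Ea -!scalemxAr -!scalemxAl Eg.
    rewrite -!scalemxAr -!scalemxAl => E.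
    move: (c^T *m _ *m c) E => X E; apply/matrixP => i j.
    have /matrixP/(_ i j) := E; rewrite !mxE => {}E.
    apply: (mulfI pid0); apply: (mulrI al_u); rewrite E.
    by rewrite (mulrCA al) -(mulrA al^-1) mulVKr // mulrCA.
  rewrite /cs; have -> : incl (b *m g) = incl (a *m g) *m incl c by rewrite -map_mxM Ec.
  symmetry.
  apply: (@lcoset_id _ _ (@GSp K n) Gamma_o Delta_o);
    by [exact: GSp_unit|exact: Delta_GSp|exact: Gamma_Delta|exact: Gamma_M
       |exact: Gamma_V|exists c].
pose phi (t : 'M['I_(size s).+1]_(n + n)) :=
  xget set0 [set C | exists a, [/\ GSp a, map_mx key a = t & C = cs a]].
apply: (sub_finite_set (B := range phi)); last first.
  by apply: finite_image; apply: finite_finset.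
move=> _ [x /indic_neq0[_ [b [[a Ga <-] Gb ->]]] <-].
exists (map_mx key a) => //; rewrite /phi.
set S := [set C | _].
have : S (xget set0 S) by apply: xgetPex; exists (cs a), a.
case=> a' [Ga' Ea' ->]; rewrite (csE _ _ Ga' Ga Ea') /cs map_mxM; symmetry.
apply: (@lcoset_id _ _ (@GSp K n) Gamma_o Delta_o);
  by [exact: GSp_unit|exact: Delta_GSp|exact: Gamma_Delta|exact: Gamma_M
     |exact: Gamma_V|exact: Gb].
Qed.

End Finiteness.

Section Generators.
Variable pi : o.

Definition T_mx (k : nat) : 'M[o]_(n + n) :=
  if k == 0%N then diag_mx (row_mx (const_mx 1) (const_mx pi))
  else diag_mx (row_mx (\row_(j < n) (if (j < n - k)%N then 1 else pi))
                       (\row_(j < n) (if (j < n - k)%N then pi ^+ 2 else pi))).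

Definition hecke_T (k : nat) : hecke := hecke_elt (T_mx k).

Lemma diag_GSp (u v : 'rV[o]_n) d : (forall j, u 0 j * v 0 j = d) ->
  (diag_mx (row_mx u v))^T *m sympl o n *m diag_mx (row_mx u v) = d *: sympl o n.
Proof.
move=> uv; have uvE : diag_mx u *m diag_mx v = d%:M.
  rewrite mulmx_diag -diag_const_mx; congr diag_mx; apply/rowP => j.
  by rewrite !mxE uv.
rewrite tr_diag_mx diag_mx_row /sympl !mulmx_block.
rewrite !(mul0mx, mulmx0, mul1mx, mulmx1, add0r, addr0, mulmxN, mulNmx) uvE.
by rewrite diag_mxC uvE scale_block_mx scaler0 scalerN scalemx1.
Qed.

Lemma hecke_TE (F : finFieldType) (red : {rmorphism o -> F}) k :
  is_dvr o -> residue_map red -> uniformizer pi ->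
  hecke_val (hecke_T k) = elt_fun (T_mx k).
Proof.
move=> dvr rr pu; have p0 := uniformizer_neq0 dvr pu; rewrite /hecke_T /hecke_elt; apply: (@insubdK _ _ hecke).
have [->|k0] := eqVneq k 0%N.
  apply: (elt_hecke rr pu p0 (d := 1)); apply: diag_GSp => j.
  by rewrite !mxE mul1r expr1.
apply: (elt_hecke rr pu p0 (d := 2)); rewrite /T_mx (negbTE k0).
by apply: diag_GSp => j; rewrite !mxE; case: ifP => _; rewrite ?mul1r ?expr2.
Qed.

End Generators.
End Hecke.

Section Lattices.
Variables (o : idomainType) (pi : o).

Definition submodule (V : lmodType o) (L : set V) : Prop :=
  [/\ L 0, (forall u v, L u -> L v -> L (u + v)) & (forall a v, L v -> L (a *: v))].

(* V / L is isomorphic to W / N, the isomorphism being given by a map on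
   representatives *)
Definition quot_iso (V W : lmodType o) (L : set V) (N : set W) : Prop :=
  exists phi : V -> W,
  [/\ forall a u v, N (phi (a *: u + v) - (a *: phi u + phi v)),
      forall v, N (phi v) <-> L v
    & forall w, exists v, N (phi v - w)].

(* (o/p)^a (+) (o/p^2)^b is o^(a+b) / type_sub a b *)
Definition type_sub (a b : nat) : set 'rV[o]_(a + b) :=
  [set v | (forall i : 'I_a, pideal pi 1 (v 0 (lshift b i))) /\
           (forall j : 'I_b, pideal pi 2 (v 0 (rshift a j)))].

Definition lattices (n a b : nat) : set (set 'rV[o]_n) :=
  [set L | submodule L /\ quot_iso L (@type_sub a b)].

Definition cosets (V : lmodType o) (L : set V) : set (set V) :=
  [set [set x + v | v in L] | x in [set: V]].

(* |V : L|, or 0 if this index is infinite *)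
Definition mod_index (V : lmodType o) (L : set V) : nat :=
  (#|` fset_set (cosets L)|)%fset.

Definition proj_first (n i : nat) (le_i_n : (i <= n)%N) (v : 'rV[o]_n) : 'rV[o]_i :=
  \row_j v 0 (widen_ord le_i_n j).

(* i : 'I_n stands for the index i + 1 of the mathematical text.  For L of
   finite index, the indices below are powers of q, the second one dividing the
   first one. *)
Definition delta (q n : nat) (L : set 'rV[o]_n) (i : 'I_n) : nat :=
  (trunc_log q (mod_index (proj_first (ltn_ord i) @` L)) -
   trunc_log q (mod_index (proj_first (ltnW (ltn_ord i)) @` L)))%N.

(* 'X_(lift ord0 i) is x_(i+1), and 'X_ord0 is x_0 *)
Definition omega (q n a b : nat) : {mpoly rat[n.+1]} :=
  \sum_(L \in @lattices n a b)
    \prod_(i < n) ((q%:R ^- i.+1 : rat) *: 'X_(lift ord0 i)) ^+ delta q L i.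

End Lattices.

Definition card_sym (F : finFieldType) (a r : nat) : nat :=
  #|[pred A : 'M[F]_a | (A^T == A) && (\rank A == r)]|.

(* the ring homomorphism x_0 |-> q^l, x_i |-> q^i (0 < i < n), x_n |-> q^(n-l) *)
Definition psi (n : nat) (l : int) (q : nat) (p : {mpoly rat[n.+1]}) : rat :=
  p.@[fun i : 'I_n.+1 =>
        if i == 0%N :> nat then (q%:R : rat) ^ l
        else if i == n :> nat then (q%:R : rat) ^ (n%:Z - l)
        else (q%:R : rat) ^+ i].

Section Phi.
Variables (F : fieldType) (Y : F).

Definition Ybinom (a b : nat) : F :=
  \prod_(1 <= i < b.+1) ((1 - Y ^+ (a - i + 1)) / (1 - Y ^+ i)).

Definition Delta (n k : nat) : F :=
  if k == 0%N then \prod_(1 <= i < (n - k).+1) (1 + Y ^+ (k + i))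
  else \prod_(1 <= i < (n - k).+1) (1 + Y ^+ (k + i))
       * Y ^+ 'C(n - k + 1, 2) * Ybinom n k.

Definition PhiC (n k : nat) (l : int) : F :=
  if k == 0%N then (Y ^ l + Y ^+ n) * \prod_(1 <= i < n) (1 + Y ^+ i)
  else Delta n k / (Y ^+ (2 * n) - 1)
       * (Y ^ (2 * l) - Y ^ (2 * l - n%:Z + k%:Z) + Y ^ (l + n%:Z + k%:Z)
          - 2 * Y ^ l + Y ^ (l - n%:Z + k%:Z) + Y ^+ (2 * n) - Y ^+ (n + k)).

End Phi.

(* Main.v *)
Require Import Defs.
From HB Require Import structures.
From mathcomp Require Import all_boot all_order all_algebra.
From mathcomp Require Import finmap boolp classical_sets functions cardinality fsbigop.
From mathcomp Require Import mpoly.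
From mathcomp Require Import mxabelem.
From mathcomp Require Import zify ring.

(* For k >= 1, specialising x_i at q^i for i < n and x_n at q^(n-l) turns
   omega_(a,b) into the sum of u^(delta_n L), u = q^(-l), over the lattices L of
   type (a, b).  Such an L is the kernel of a surjection from o^n onto
   (o/p)^a (+) (o/p^2)^b, and the surjections with a given kernel form a torsor
   under the automorphism group of the target.  Surjections are matrices whose
   reduction has full rank, and delta_n L is the exponent of the annihilator of
   their last row, so everything reduces to counting matrices of full rank over
   F_q with some rows in a subspace.  Writing [n; a, b] for the q-trinomial
   coefficient with lower entries a, b, n-a-b, there are q^(b(n-a-b)) [n; a, b]
   lattices, and the proportions of those with delta_n = 0 and delta_n = 2 are
   q^(-b) (q^(n-a-b) - 1) / (q^n - 1) and (q^n - q^(n-b)) / (q^n - 1).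

   With N = n - k and a = k + m, all sums that remain are of the shape
   sum_(m,b) q^(b(N+k+1)) [N; m, b] S_m, where S_m is the number of invertible
   symmetric m x m matrices.  The number of symmetric r x r matrices of rank m
   is [r choose m]_q S_m, so the sum over m for fixed b counts all symmetric
   matrices of size N - b, and the sum over b is an instance of the q-binomial
   theorem. *)

Set Implicit Arguments.
Unset Strict Implicit.
Unset Printing Implicit Defensive.

Import Order.TTheory GRing.Theory Num.Theory.

Local Open Scope ring_scope.

(** * Matrices over a finite field *)

Section Counting.
Variable F : finFieldType.
Local Notation q := #|F|.
Local Notation Y := (q%:R : rat).

Lemma card_submx (m n : nat) (V : 'M[F]_(m, n)) :
  #|[set v : 'rV_n | (v <= V)%MS]| = (q ^ \rank V)%N.
Proof. by rewrite -card_rowg; apply: eq_card => v; rewrite !inE. Qed.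

Lemma row_free_col_mx (r n : nat) (v : 'rV[F]_n) (A : 'M[F]_(r, n)) :
  row_free (col_mx v A) = row_free A && ~~ (v <= A)%MS.
Proof.
have [vA|vA] := boolP (v <= A)%MS.
  rewrite andbF; apply/negbTE; rewrite /row_free -addsmxE (addsmx_idPr vA).
  by rewrite neq_ltn ltnS rank_leq_row.
rewrite andbT /row_free -addsmxE.
have v1 : \rank v = 1%N.
  rewrite rank_rV; have [v0|//] := eqVneq v 0.
  by rewrite v0 sub0mx in vA.
have cap0 : \rank (v :&: A)%MS = 0%N.
  apply/eqP; rewrite -leqn0 -ltnS; apply: leq_trans (_ : \rank v <= _)%N; last by rewrite v1.
  rewrite ltn_neqAle mxrankS ?capmxSl // andbT; apply: contra vA => /eqP E.
  have : (v <= v :&: A)%MS by rewrite -(geq_leqif (mxrank_leqif_sup (capmxSl v A))) E.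
  by rewrite sub_capmx => /andP[].
by have := mxrank_sum_cap v A; rewrite cap0 v1 addn0 => ->; rewrite eqSS.
Qed.

Lemma card_col_mx (T : finType) (m r n : nat) (P : pred 'M[T]_(m + r, n)) :
  #|[set A | P A]| =
  (\sum_(A : 'M[T]_(r, n)) #|[set v : 'M[T]_(m, n) | P (col_mx v A)]|)%N.
Proof.
rewrite -sum1_card (reindex (fun p : 'M[T]_(r, n) * 'M[T]_(m, n) => col_mx p.2 p.1)) /=.
  under eq_bigl do rewrite inE.
  rewrite -(pair_big_dep xpredT (fun A v => P (col_mx v A)) (fun _ _ => 1%N)) /=.
  by apply: eq_bigr => A _; rewrite -sum1_card; apply: eq_bigl => v; rewrite inE.
exists (fun A => (dsubmx A, usubmx A)) => [[A v] _|A _] /=.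
  by rewrite col_mxKu col_mxKd.
by rewrite vsubmxK.
Qed.

(** Choose the rows from the last to the first: those below row [i] lie in [V i] because the flag
    decreases, so row [i] must avoid a subspace of [V i] of dimension [r - i.+1]. *)
Lemma card_row_free_flag (r n : nat) (V : nat -> 'M[F]_n) :
  (forall i, V i.+1 <= V i)%MS ->
  #|[set A : 'M[F]_(r, n) | row_free A && [forall i, (row i A <= V i)%MS]]|%:R
  = \prod_(i < r) (Y ^+ \rank (V i) - Y ^+ (r - i.+1)).
Proof.
elim: r V => [|r IH] V Vdec.
  rewrite big_ord0 (_ : [set A | _] = [set: 'M[F]_(0, n)]%SET) ?cardsT ?card_mx ?mul0n //.
  apply/setP => A; rewrite !inE /row_free (flatmx0 A) mxrank0 eqxx /=.
  by apply/forallP => -[].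
have Vdec0 i : (V i <= V 0%N)%MS.
  by elim: i => // i IHi; apply: submx_trans IHi.
rewrite big_ord_recl /= subn1 /=.
under eq_bigr do rewrite /bump add1n subSS.
rewrite -(IH (fun i => V i.+1)) => [|i]; last exact: Vdec.
rewrite (@card_col_mx _ 1 r) -sum1_card natr_sum mulr_sumr big_mkcond [RHS]big_mkcond natr_sum.
apply: eq_bigr => A _.
have E (v : 'rV[F]_n) : [forall i, (row i (col_mx v A : 'M_(r.+1, n)) <= V i)%MS] =
      (v <= V 0%N)%MS && [forall i : 'I_r, (row i A <= V i.+1)%MS].
  apply/forallP/andP => [H|[H0 /forallP H] i].
    split; last apply/forallP => i.
      have := H (lshift r (ord0 : 'I_1) : 'I_(1 + r)).
      by rewrite -[row _ _]/(row (lshift r (ord0 : 'I_1)) (col_mx v A)) rowKu row_id.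
    have := H (rshift 1 i).
    by rewrite -[row _ _]/(row (rshift 1 i) (col_mx v A)) rowKd.
  case: (split_ordP (i : 'I_(1 + r))) => j ->.
    by rewrite -[row _ _]/(row (lshift r j) (col_mx v A)) rowKu (ord1 j) row_id.
  by rewrite -[row _ _]/(row (rshift 1 j) (col_mx v A)) rowKd.
case: ifP; rewrite inE; [move=> /andP[fA VA]|move=> NA]; last first.
  rewrite (_ : [set v | _] = finset.set0) ?cards0 //; apply/setP => v.
  rewrite !inE row_free_col_mx E; apply: contraFF NA => /andP[/andP[-> _] /andP[_ ->]] //.
have AV : (A <= V 0%N)%MS.
  by apply/row_subP => i; apply: submx_trans (Vdec0 i.+1); apply: (forallP VA).
rewrite mulr1 (_ : [set v | _] =
  [set v | (v <= V 0%N)%MS] :\: [set v | (v <= A)%MS]); last first.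
  by apply/setP => v; rewrite !inE row_free_col_mx E fA VA andbT.
have sub : [set v | (v <= A)%MS] \subset [set v : 'rV_n | (v <= V 0%N)%MS].
  by apply/fintype.subsetP => v; rewrite !inE => /submx_trans; apply.
rewrite cardsD (finset.setIidPr sub) natrB ?subset_leq_card // !card_submx !natrX.
by rewrite (eqP fA).
Qed.

(** A two-step flag: the whole space for the first [a] rows, the span of [V] for the last [b]. *)
Lemma card_sub_flag (a b n m : nat) (V : 'M[F]_(m, n)) :
  #|[set A : 'M[F]_(a + b, n) | row_free A && (dsubmx A <= V)%MS]|%:R
  = (\prod_(i < b) (Y ^+ \rank V - Y ^+ i)) *
    \prod_(i < a) (Y ^+ n - Y ^+ (b + i)).
Proof.
pose W i : 'M[F]_n := if (i < a)%N then 1%:M else <<V>>%MS.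
have Wdec i : (W i.+1 <= W i)%MS.
  rewrite /W; case: (ltnP i a) => [_|ai]; first exact: submx1.
  by rewrite ltnNge (leq_trans ai).
rewrite (_ : [set A | _] =
   [set A | row_free A && [forall i, (row i A <= W i)%MS]]); last first.
  apply/setP => A; rewrite !inE; congr (_ && _).
  apply/row_subP/forallP => [H i|H i].
    rewrite /W; case: (split_ordP i) => j ->; first exact: submx1.
    by rewrite genmxE; have := H j; rewrite row_dsubmx.
  by have := H (rshift a i); rewrite /W /= ltnNge leq_addr /= genmxE row_dsubmx.
rewrite card_row_free_flag // big_split_ord /= mulrC; congr (_ * _).
  rewrite (reindex_inj rev_ord_inj) /=; apply: eq_bigr => i _.
  have ib := ltn_ord i.
  by rewrite /W ltnNge leq_addr /= genmxE; congr (_ - _ ^+ _); lia.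
rewrite (reindex_inj rev_ord_inj) /=; apply: eq_bigr => i _.
have ib := ltn_ord i.
rewrite /W (_ : (_ < a)%N); last by lia.
by rewrite mxrank1; congr (_ - _ ^+ _); lia.
Qed.

Lemma card_row_free (r n : nat) :
  #|[set A : 'M[F]_(r, n) | row_free A]|%:R = \prod_(i < r) (Y ^+ n - Y ^+ i).
Proof.
have := @card_sub_flag 0 r n n 1%:M; rewrite big_ord0 mulr1 mxrank1 => <-.
congr (_%:R); apply: eq_card => A; rewrite !inE submx1 andbT //.
Qed.

Definition card_sym_unit (r : nat) : rat := #|[set S : 'M[F]_r | (S^T == S) && row_free S]|%:R.

Lemma row_free_basis (m n r : nat) (A : 'M[F]_(m, n)) : \rank A = r ->
  exists2 C : 'M[F]_(r, n), row_free C & (C :=: A)%MS.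
Proof.
by move=> <-; exists (row_base A); [exact: row_base_free|exact: eq_row_base].
Qed.

(* [(C, S) |-> C^T S C] is [GL_r]-invariant with simply transitive fibers. *)
Lemma card_sym_congr (a r : nat) :
  (card_sym F a r)%:R * #|[set g : 'M[F]_r | row_free g]|%:R =
  #|[set C : 'M[F]_(r, a) | row_free C]|%:R * card_sym_unit r.
Proof.
rewrite /card_sym /card_sym_unit -!natrM; congr (_%:R).
pose X := finset.setX [set C : 'M[F]_(r, a) | row_free C]
               [set S : 'M[F]_r | (S^T == S) && row_free S].
pose P := [set A : 'M[F]_a | (A^T == A) && (\rank A == r)].
pose f (p : 'M[F]_(r, a) * 'M[F]_r) := p.1^T *m p.2 *m p.1.
rewrite -cardsX -/X.
have fP p : p \in X -> f p \in P.
  case: p => C S; rewrite !inE /= => /and3P[fC /eqP sS fS].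
  rewrite /f /= !trmx_mul trmxK sS mulmxA eqxx /=.
  have uS : S \in unitmx by rewrite -row_free_unit.
  have -> : \rank (C^T *m S *m C) = \rank (C^T *m S).
    by rewrite mxrankMfree.
  by rewrite -mxrank_tr trmx_mul trmxK mxrankMfree // mxrank_tr; exact: fS.
rewrite -[RHS]sum1_card (partition_big f (fun A => A \in P)) //=.
transitivity (\sum_(A in P) #|[set g : 'M[F]_r | row_free g]|)%N.
  by rewrite sum_nat_const; congr (_ * _)%N; apply: eq_card => A; rewrite !inE.
apply: eq_bigr => A; rewrite inE => /andP[/eqP sA /eqP rA].
rewrite -sum1_card.
have [C0 fC0 C0A] := row_free_basis rA.
have [D DC] := row_freeP fC0.
have [S0 S0E] : {S0 : 'M[F]_r | S0 = D^T *m A *m D} by exists (D^T *m A *m D).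
(* Multiplying by [D] and then by [C0] fixes the row space of [C0], hence the rows of [A]; the
   symmetry of [A] gives the same on the left. *)
have AE : A = C0^T *m S0 *m C0.
  have H (B : 'M[F]_a) : (B <= A)%MS -> B *m D *m C0 = B.
    move=> BA; have /submxP[Z ->] : (B <= C0)%MS by rewrite C0A.
    by rewrite -(mulmxA Z) DC mulmx1.
  have HA := H _ (submx_refl A).
  rewrite S0E !mulmxA -(mulmxA _ A) -trmx_mul -(mulmxA _ _ C0).
  rewrite -!mulmxA (mulmxA A) HA.
  by rewrite -[A in RHS]sA -trmx_mul mulmxA HA sA.
have sS0 : S0^T = S0 by rewrite S0E !trmx_mul trmxK sA mulmxA.
have fS0 : row_free S0.
  rewrite /row_free eqn_leq rank_leq_row /= -{1}rA {1}AE.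
  by rewrite -mulmxA (leq_trans (mxrankM_maxr _ _)) // mxrankM_maxl.
(* The fiber over [A] is the orbit of [(C0, S0)]; the group element leading to [(C, S)] is recovered
   as [C *m D]. *)
pose h (g : 'M[F]_r) := (g *m C0, (invmx g)^T *m S0 *m invmx g).
have uE g : row_free g -> f (h g) = A.
  rewrite row_free_unit => ug; rewrite /f /h /= !trmx_mul trmx_inv !mulmxA.
  rewrite -(mulmxA C0^T) mulmxV ?unitmx_tr // mulmx1 mulmxKV //.
rewrite (reindex h) /=; last first.
  exists (fun p => p.1 *m D) => [g _|[C S]].
    by rewrite /h /= -mulmxA DC mulmx1.
  rewrite !inE /= => /andP[/and3P[fC _ _] /eqP fE].
  have AC : (A <= C)%MS by rewrite -fE /f /= submxMl.
  have CA : (C <= C0)%MS.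
    by rewrite C0A -(geq_leqif (mxrank_leqif_sup AC)) rA (eqP fC).
  have gC : C *m D *m C0 = C.
    by have /submxP[Z ->] := CA; rewrite -(mulmxA Z) DC mulmx1.
  have ug : C *m D \in unitmx.
    rewrite -row_free_unit /row_free eqn_leq rank_leq_row -{1}(eqP fC) -{1}gC.
    exact: mxrankM_maxl.
  rewrite /h gC; congr (_, _).
  have gS : (C *m D)^T *m S *m (C *m D) = S0.
    by rewrite S0E -fE /f /= trmx_mul !mulmxA.
  rewrite -gS; move: (C *m D) ug => g ug.
  by rewrite !mulmxA -trmx_mul mulmxV // trmx1 mul1mx mulmxK.
apply: eq_bigl => g; rewrite !inE.
apply/idP/idP => [fg|]; last first.
  case/andP=> /and3P[+ _ _] _; rewrite /h /= /row_free => /eqP gC0.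
  by rewrite eqn_leq rank_leq_row -{1}gC0 mxrankM_maxl.
have ug : g \in unitmx by rewrite -row_free_unit.
rewrite (uE g fg) eqxx andbT /=; apply/and3P; split.
- by rewrite /row_free mxrankMfree.
- by rewrite !trmx_mul trmxK sS0 mulmxA.
- rewrite /row_free mxrankMfree ?row_free_unit ?unitmx_inv //.
  rewrite -mxrank_tr trmx_mul trmxK sS0 mxrankMfree //.
  by rewrite row_free_unit unitmx_inv.
Qed.

(** Induction on the size: the first row, with [m.+1] free entries, determines the first column, and
    the remaining block is symmetric. *)
Lemma card_symmx (m : nat) :
  #|[set A : 'M[F]_m | A^T == A]| = (q ^ 'C(m.+1, 2))%N.
Proof.
elim: m => [|m IH].
  rewrite expn0; apply/eqP/cards1P; exists 0; apply/setP => A.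
  by rewrite !inE (flatmx0 A) trmx0 !eqxx.
pose f (p : 'M[F]_1 * 'rV[F]_m * 'M[F]_m) : 'M[F]_(1 + m) :=
  block_mx p.1.1 p.1.2 p.1.2^T p.2.
pose X := finset.setX (finset.setX [set: 'M[F]_1]%SET [set: 'rV[F]_m]%SET)
  [set S : 'M[F]_m | S^T == S].
have fP (A : 'M[F]_(1 + m)) : A^T = A ->
    A = f (ulsubmx A, ursubmx A, drsubmx A) /\ (drsubmx A)^T = drsubmx A.
  rewrite -[A](@submxK _ 1 m 1 m) tr_block_mx => /eq_block_mx[_ E _ sS].
  by rewrite block_mxKul block_mxKur block_mxKdr /f /= -E trmxK.
rewrite (_ : [set A | _] = f @: X); last first.
  apply/setP => A; rewrite inE; apply/eqP/imsetP => [sA|[[[x v] S]]].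
    have [AE dS] := fP A sA.
    exists (ulsubmx (A : 'M_(1 + m)), ursubmx (A : 'M_(1 + m)), drsubmx (A : 'M_(1 + m))) => //.
    by rewrite !inE /= dS eqxx.
  rewrite !inE /= => /eqP sS ->; rewrite /f /=.
  apply: (eq_trans (tr_block_mx x v v^T S)).
  rewrite /f /= trmxK sS; congr block_mx.
  by apply/matrixP => i j; rewrite !mxE (ord1 i) (ord1 j).
rewrite card_imset; last first.
  by move=> [[x v] S] [[x' v'] S']; move=> /(@eq_block_mx _ 1 m 1 m)[/= -> -> _ ->].
by rewrite !cardsX !cardsT !card_mx IH !mul1n -!expnD [in RHS]binS bin1; congr (_ ^ _)%N; lia.
Qed.

Lemma sum_card_sym (m : nat) :
  (\sum_(r < m.+1) card_sym F m r)%N = (q ^ 'C(m.+1, 2))%N.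
Proof.
rewrite -card_symmx -sum1_card.
rewrite (partition_big (fun A : 'M_m => inord (\rank A) : 'I_m.+1) xpredT) //=.
apply: eq_bigr => r _; rewrite /card_sym -sum1_card; apply: eq_bigl => A; rewrite !inE.
by rewrite -[inord _ == r]val_eqE /= inordK // ltnS rank_leq_row.
Qed.
End Counting.

(** * q-binomial identities *)

Lemma big_ord_trunc (R : nmodType) (m n : nat) (f : nat -> R) : (m <= n)%N ->
  (forall i, (m <= i)%N -> f i = 0) -> \sum_(i < n) f i = \sum_(i < m) f i.
Proof.
move=> mn f0; rewrite (big_ord_widen n f mn) [RHS]big_mkcond.
by apply: eq_bigr => i _; case: ltnP => // /f0.
Qed.

Lemma binD2 (a b : nat) : 'C((a + b)%N, 2) = ('C(a, 2) + 'C(b, 2) + a * b)%N.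
Proof. elim: a => [|a IH]; first by rewrite addn0.
by rewrite addSn !binS !bin1 IH; lia. Qed.

Lemma bin2_sq (b : nat) : ('C(b, 2) + 'C(b, 2) + b = b * b)%N.
Proof. by elim: b => // b IH; rewrite binS bin1; lia. Qed.

(** As [m] is not assumed to be a power of [q], this yields [delta] from a ratio of indices
    alone. *)
Lemma trunc_log_mulX q m d : (1 < q)%N -> (0 < m)%N ->
  trunc_log q (m * q ^ d) = (trunc_log q m + d)%N.
Proof.
move=> q1 m0; elim: d => [|d IH]; first by rewrite muln1 addn0.
by rewrite expnS mulnCA trunc_logMp ?muln_gt0 ?m0 ?expn_gt0 ?IH ?addnS // ltnW.
Qed.

Section Gauss.
Variables (K : fieldType) (q : K).

Definition qfact (n : nat) : K := \prod_(i < n) (q ^+ i.+1 - 1).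

(** The Gaussian binomial coefficient, by a Pascal recurrence so that no division enters. *)
Fixpoint qbinom (n k : nat) : K :=
  match n, k with
  | _, 0 => 1
  | 0, _.+1 => 0
  | n'.+1, k'.+1 => qbinom n' k'.+1 + q ^+ (n' - k') * qbinom n' k'
  end.

(* The q-trinomial coefficient with lower entries [a], [b] and [n - a - b]. *)
Definition qmulti (n a b : nat) : K := qbinom n b * qbinom (n - b) a.

(* The number of injective linear maps from F_q^r to F_q^n. *)
Definition frames (n r : nat) : K := \prod_(i < r) (q ^+ n - q ^+ i).

Lemma qbinom0 n : qbinom n 0 = 1. Proof. by case: n. Qed.

Lemma qbinomS n k :
  qbinom n.+1 k.+1 = qbinom n k.+1 + q ^+ (n - k) * qbinom n k.
Proof. by []. Qed.

Lemma qbinom_small n k : (n < k)%N -> qbinom n k = 0.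
Proof.
elim: n k => [|n IH] [|k] //= nk.
by rewrite !IH ?mulr0 ?addr0 //; lia.
Qed.

Lemma qfactS n : qfact n.+1 = qfact n * (q ^+ n.+1 - 1).
Proof. by rewrite /qfact big_ord_recr. Qed.

(** The induction rests on q^(n+1) - 1 = (q^(n-k) - 1) + q^(n-k) (q^(k+1) - 1), whose two parts
    match the two terms of the recurrence. *)
Lemma qbinom_fact n k : (k <= n)%N -> qfact k * qfact (n - k) * qbinom n k = qfact n.
Proof.
elim: n k => [|n IH] [|k] // kn; first by rewrite /qfact big_ord0 !mul1r.
  by rewrite qbinom0 /qfact big_ord0 mul1r mulr1.
rewrite qbinomS subSS mulrDr; have E2 := IH k kn.
have [nk|nk] := eqVneq k n.
  move: E2; rewrite {}nk subnn (@qbinom_small n n.+1) // mulr0 add0r expr0 mul1r !qfactS => E2.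
  by rewrite -[in RHS]E2; ring.
have E1 := IH k.+1 ltac:(lia).
have nk1 : (n - k = (n - k.+1).+1)%N by lia.
rewrite nk1 qfactS -nk1 in E2.
transitivity (qfact n * (q ^+ (n - k) - 1) + q ^+ (n - k) * (qfact n * (q ^+ k.+1 - 1))).
  by rewrite -{1}E1 -E2 nk1 !qfactS -nk1; ring.
rewrite qfactS (_ : n.+1 = (n - k + k.+1)%N); last by lia.
by rewrite exprD; ring.
Qed.

(** In the recurrence, the first terms rebuild the sum for [n] and the second terms rebuild it
    multiplied by [z * q ^+ n.+1]. *)
Lemma qbinom_thm n (z : K) :
  \sum_(b < n.+1) q ^+ 'C(b.+1, 2) * qbinom n b * z ^+ b
  = \prod_(i < n) (1 + z * q ^+ i.+1).
Proof.
elim: n => [|n IH].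
  by rewrite big_ord_recl !big_ord0 /= !mulr1 addr0.
rewrite [RHS]big_ord_recr /= -IH big_ord_recl /= bin_small // !mulr1.
have -> : \sum_(i < n.+1) q ^+ 'C((bump 0 i).+1, 2) *
      (qbinom n i.+1 + q ^+ (n - i) * qbinom n i) * z ^+ (bump 0 i) =
    \sum_(i < n.+1) q ^+ 'C(i.+2, 2) * qbinom n i.+1 * z ^+ i.+1 +
    z * q ^+ n.+1 * \sum_(i < n.+1) q ^+ 'C(i.+1, 2) * qbinom n i * z ^+ i.
  rewrite mulr_sumr -big_split; apply: eq_bigr => i _ /=.
  rewrite mulrDr mulrDl; congr (_ + _).
  have -> : q ^+ n.+1 = q ^+ (n - i) * q ^+ i.+1.
    by rewrite -exprD; congr (_ ^+ _); have := ltn_ord i; lia.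
  by rewrite (binS i.+1 1) bin1 [q ^+ (_ + _)]exprD /bump leq0n add1n !exprS; ring.
set S := \sum_(i < n.+1) q ^+ 'C(i.+1, 2) * qbinom n i * z ^+ i.
have SE : S = 1 + \sum_(i < n) q ^+ 'C(i.+2, 2) * qbinom n i.+1 * z ^+ i.+1.
  by rewrite /S big_ord_recl /= qbinom0 bin_small // !mulr1.
rewrite [in LHS]big_ord_recr /= qbinom_small // mulr0 mul0r addr0 addrA -SE.
by ring.
Qed.

(** * Quotient formulas, for q nonzero and not a root of unity *)

Section Generic.
Hypothesis q0 : q != 0.
Hypothesis q1 : forall n, q ^+ n.+1 - 1 != 0.

Lemma qfact_neq0 n : qfact n != 0.
Proof. by apply/prodf_neq0 => i _; apply: q1. Qed.

Lemma qbinomE n k : (k <= n)%N -> qbinom n k = qfact n / (qfact k * qfact (n - k)).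
Proof.
move=> kn; rewrite -(qbinom_fact kn) [X in X / _]mulrC mulfK //.
by rewrite mulf_neq0 ?qfact_neq0.
Qed.

Lemma qmultiE n a b : (a + b <= n)%N ->
  qmulti n a b = qfact n / (qfact a * qfact b * qfact (n - a - b)).
Proof.
move=> abn; rewrite /qmulti !qbinomE; try lia.
rewrite (_ : n - b - a = n - a - b)%N; last by lia.
have := qfact_neq0 (n - b); have := qfact_neq0 a; have := qfact_neq0 b.
have := qfact_neq0 (n - a - b) => *.
by field; do ?[apply/andP; split].
Qed.

Lemma qmulti_small n a b : (n < a + b)%N -> qmulti n a b = 0.
Proof.
move=> lt; rewrite /qmulti; have [nb|bn] := ltnP n b.
  by rewrite qbinom_small // mul0r.
by rewrite [X in _ * X]qbinom_small ?mulr0 //; lia.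
Qed.

Lemma framesE n r : (r <= n)%N -> frames n r * qfact (n - r) = q ^+ 'C(r, 2) * qfact n.
Proof.
elim: r => [|r IH] rn; first by rewrite /frames big_ord0 mul1r subn0 mul1r.
rewrite /frames big_ord_recr /= -/(frames n r) binS bin1 exprD.
have nr : (n - r = (n - r.+1).+1)%N by lia.
transitivity (q ^+ r * (frames n r * qfact (n - r))); last by rewrite IH; [ring|lia].
rewrite nr qfactS -nr (_ : q ^+ n = q ^+ (n - r) * q ^+ r); first by ring.
by rewrite -exprD; congr (_ ^+ _); lia.
Qed.

Lemma frames_self r : frames r r = q ^+ 'C(r, 2) * qfact r.
Proof. by have := framesE (leqnn r); rewrite subnn /qfact !big_ord0 mulr1. Qed.

Lemma frames_self_neq0 r : frames r r != 0.
Proof. by rewrite frames_self mulf_neq0 ?expf_neq0 ?qfact_neq0. Qed.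

Lemma frames_qbinom n r : (r <= n)%N -> frames n r = qbinom n r * frames r r.
Proof.
move=> rn; apply: (mulIf (qfact_neq0 (n - r))).
by rewrite framesE // frames_self -(qbinom_fact rn); ring.
Qed.

(** Both sides are [frames n.+1 r.+1], with the first factor, respectively the last one, split
    off. *)
Lemma frames_pred n r :
  frames n r * (q ^+ n.+1 - 1) * q ^+ r = frames n.+1 r * (q ^+ n.+1 - q ^+ r).
Proof.
transitivity (frames n.+1 r.+1); last by rewrite /frames big_ord_recr.
rewrite /frames big_ord_recl /= expr0 (mulrC _ (_ - 1)) -mulrA; congr (_ * _).
under [RHS]eq_bigr do rewrite /bump add1n !exprS -mulrBr.
by rewrite big_split /= prodr_const card_ord mulrC.
Qed.

Lemma frames_split n a b :
  frames n (a + b) = frames n b * \prod_(i < a) (q ^+ n - q ^+ (b + i)).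
Proof. by rewrite addnC /frames big_split_ord. Qed.

(** The left side counts surjections onto the module of type [(a, b)], and the last factor on the
    right counts its automorphisms. What remains is the number of lattices, the q-trinomial being a
    product of two q-binomials. *)
Lemma frames_qmulti n a b : (a + b <= n)%N ->
  q ^+ (n * b) * frames n (a + b) =
  q ^+ (b * (n - a - b)) * (qbinom n (a + b) * qbinom (a + b) a) *
  (q ^+ ((a + b) * b) * (frames b b * \prod_(i < a) (q ^+ (a + b) - q ^+ (b + i)))).
Proof.
move=> abn; rewrite frames_qbinom // frames_split (@frames_qbinom _ b) ?leq_addl //.
have -> : qbinom (a + b) b = qbinom (a + b) a.
  by rewrite !qbinomE ?leq_addl ?leq_addr // addnK addKn (mulrC (qfact b)).
have -> : q ^+ (n * b) = q ^+ (b * (n - a - b)) * q ^+ ((a + b) * b).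
  by rewrite -exprD; congr (_ ^+ _); nia.
by ring.
Qed.

(** The left side counts the surjections from o^(n+1) whose kernel has last [delta] at most 1; the
    final factor is their proportion, one minus that of [delta] equal to 2. *)
Lemma frames_le1 n a b : (b <= n.+1)%N ->
  q ^+ (n.+1 * b) * (frames n b * \prod_(i < a) (q ^+ n.+1 - q ^+ (b + i))) =
  q ^+ (n.+1 * b) * frames n.+1 (a + b) *
    (1 - (q ^+ n.+1 - q ^+ n.+1 / q ^+ b) / (q ^+ n.+1 - 1)).
Proof.
move=> bn; rewrite frames_split; have qb := expf_neq0 b q0; have qn1 := q1 n.
have -> : frames n b = frames n.+1 b * (q ^+ n.+1 - q ^+ b) / ((q ^+ n.+1 - 1) * q ^+ b).
  by rewrite -frames_pred -(mulrA (frames n b)) mulfK // mulf_neq0.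
by field; rewrite qn1.
Qed.

(** The analogous proportion for kernels with last [delta] equal to 0. *)
Lemma frames_eq0 n a b : (a + b <= n.+1)%N ->
  q ^+ (n * b) * frames n (a + b) =
  q ^+ (n.+1 * b) * frames n.+1 (a + b) *
    (q ^- b * (q ^+ (n.+1 - a - b) - 1) / (q ^+ n.+1 - 1)).
Proof.
move=> abn; have qb := expf_neq0 b q0; have qab := expf_neq0 (a + b) q0.
have qn1 := q1 n.
have -> : frames n (a + b) =
    frames n.+1 (a + b) * (q ^+ n.+1 - q ^+ (a + b)) / ((q ^+ n.+1 - 1) * q ^+ (a + b)).
  by rewrite -frames_pred -(mulrA (frames n (a + b))) mulfK // mulf_neq0.
have -> : q ^+ (n.+1 * b) = q ^+ b * q ^+ (n * b) by rewrite mulSn exprD.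
have -> : q ^+ (n.+1 - a - b) = q ^+ n.+1 / q ^+ (a + b).
  by rewrite -subnDA expfB_cond ?(negbTE q0) //= add0n.
by field; rewrite qb qn1 qab.
Qed.

(** Terms with [m + b > N] vanish, so the square range is harmless and lets the two sums be
    exchanged. *)
Definition msum (N n : nat) (S : nat -> K) : K :=
  \sum_(m < N.+1) \sum_(b < N.+1) q ^+ (b * n.+1) * qmulti N m b * S m.

Lemma msumE (N k : nat) (S : nat -> K) :
  (forall M, \sum_(m < M.+1) qbinom M m * S m = q ^+ 'C(M.+1, 2)) ->
  msum N (N + k) S = q ^+ 'C(N.+1, 2) * \prod_(i < N) (1 + q ^+ (k + i.+1)).
Proof.
move=> hS; rewrite /msum exchange_big /=.
under [X in _ = _ * X]eq_bigr do rewrite exprD.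
rewrite -qbinom_thm mulr_sumr; apply: eq_bigr => -[b /=]; rewrite ltnS => bN _.
transitivity (q ^+ (b * (N + k).+1) * qbinom N b * q ^+ 'C((N - b).+1, 2)).
  rewrite -hS mulr_sumr
    (@big_ord_trunc _ (N - b).+1 _ (fun m => q ^+ (b * (N + k).+1) * qmulti N m b * S m))
    ?ltnS ?leq_subr //.
    by apply: eq_bigr => m _; rewrite /qmulti; ring.
  by move=> i Ni; rewrite qmulti_small ?mulr0 ?mul0r //; lia.
(* This equality of exponents makes [qbinom_thm] applicable with z = q^k. *)
rewrite mulrAC -exprD (_ : (_ + _ = 'C(N.+1, 2) + 'C(b.+1, 2) + k * b)%N).
  by rewrite !exprD exprM; ring.
have -> : N.+1 = (b + (N - b).+1)%N by lia.
have := bin2_sq b; rewrite binD2 (binS b 1) bin1.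
have : (N = b + (N - b))%N by lia.
move: (N - b)%N => c ->; move: ('C(b, 2)) ('C(_, 2)) => x y; nia.
Qed.

(** The trinomial absorbs the extra factor: [N+1; m, b] (q^(N+1-m-b) - 1) = (q^(N+1) - 1) [N; m, b].
    The power q^(-b) lowers [n.+1] to [n] in the exponent. *)
Lemma sum_qmulti_r (N n : nat) (S : nat -> K) : (N < n)%N ->
  \sum_(m < N.+2) \sum_(b < N.+2) q ^+ (b * n.+1) * qmulti N.+1 m b * S m *
     (q ^- b * (q ^+ (N.+1 - m - b) - 1)) = (q ^+ N.+1 - 1) * msum N n.-1 S.
Proof.
move=> Nn.
rewrite (@big_ord_trunc _ N.+1 _ (fun m =>
     \sum_(b < N.+2) q ^+ (b * n.+1) * qmulti N.+1 m b * S m *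
     (q ^- b * (q ^+ (N.+1 - m - b) - 1)))) //; last first.
  move=> m Nm; apply: big1 => b _; case: (posnP b) => [-> | b0].
    by rewrite (_ : N.+1 - m - 0 = 0)%N ?subrr ?mulr0 //; lia.
  by rewrite qmulti_small ?mulr0 ?mul0r //; lia.
rewrite /msum mulr_sumr; apply: eq_bigr => -[m /=]; rewrite ltnS => mN _.
rewrite (@big_ord_trunc _ N.+1 _ (fun b => q ^+ (b * n.+1) * qmulti N.+1 m b * S m *
     (q ^- b * (q ^+ (N.+1 - m - b) - 1)))) //; last first.
  move=> b Nb; case: (posnP m) => [-> | m0].
    by rewrite (_ : N.+1 - 0 - b = 0)%N ?subrr ?mulr0 //; lia.
  by rewrite qmulti_small ?mulr0 ?mul0r //; lia.
rewrite mulr_sumr; apply: eq_bigr => -[b /=]; rewrite ltnS => bN _.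
have [le|lt] := leqP (m + b) N; last first.
  rewrite (_ : N.+1 - m - b = 0)%N; last by lia.
  by rewrite subrr !mulr0 qmulti_small // !(mulr0, mul0r).
rewrite !qmultiE; try lia.
rewrite (_ : N.+1 - m - b = (N - m - b).+1)%N; last by lia.
rewrite !qfactS (_ : b * n.+1 = b * n.-1.+1 + b)%N; last by nia.
have := qfact_neq0 m; have := qfact_neq0 b; have := qfact_neq0 (N - m - b).
have := q1 (N - m - b); have qb := expf_neq0 b q0 => *.
by rewrite exprD; field; do ?[apply/andP; split].
Qed.

(** Here [N+1; m, b+1] (q^(b+1) - 1) = (q^(N+1) - 1) [N; m, b]. The term [b = 0] vanishes, and
    shifting [b] produces q^(2n). *)
Lemma sum_qmulti_l (N n : nat) (S : nat -> K) : (N < n)%N ->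
  \sum_(m < N.+2) \sum_(b < N.+2) q ^+ (b * n.+1) * qmulti N.+1 m b * S m *
     (q ^+ n - q ^+ n / q ^+ b) = (q ^+ N.+1 - 1) * q ^+ (n + n) * msum N n.-1 S.
Proof.
move=> Nn.
rewrite (@big_ord_trunc _ N.+1 _ (fun m =>
     \sum_(b < N.+2) q ^+ (b * n.+1) * qmulti N.+1 m b * S m *
     (q ^+ n - q ^+ n / q ^+ b))) //; last first.
  move=> m Nm; apply: big1 => b _; case: (posnP b) => [-> | b0].
    by rewrite expr0 divr1 subrr mulr0.
  by rewrite qmulti_small ?mulr0 ?mul0r //; lia.
rewrite /msum mulr_sumr; apply: eq_bigr => -[m /=]; rewrite ltnS => mN _.
rewrite big_ord_recl expr0 divr1 subrr mulr0 add0r mulr_sumr.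
apply: eq_bigr => -[b /=]; rewrite ltnS => bN _; rewrite /bump add1n.
have [le|lt] := leqP (m + b) N; last first.
  by rewrite !qmulti_small ?addnS // !(mulr0, mul0r).
rewrite !qmultiE; try lia.
rewrite (_ : N.+1 - m - b.+1 = N - m - b)%N; last by lia.
rewrite !qfactS (_ : b.+1 * n.+1 = b * n.-1.+1 + n + b.+1)%N; last by nia.
have := qfact_neq0 m; have := qfact_neq0 b; have := qfact_neq0 (N - m - b).
have := q1 b; have qb := expf_neq0 b.+1 q0 => *.
by rewrite !exprD; field; do ?[apply/andP; split].
Qed.

End Generic.
End Gauss.

(** * Evaluation of [PhiC] through the sums [msum] *)

Section Phi.
Variables (K : fieldType) (q : K).
Hypothesis q0 : q != 0.
Hypothesis q1 : forall n, q ^+ n.+1 - 1 != 0.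

Lemma Ybinom_qbinom n k : (k <= n)%N -> Ybinom q n k = qbinom q n k.
Proof.
move=> kn; rewrite qbinomE // /Ybinom big_add1 big_mkord /=.
elim: k kn => [|k IH] kn.
  by rewrite big_ord0 subn0 /qfact big_ord0 mul1r divff // qfact_neq0.
rewrite big_ord_recr /= IH; last by lia.
rewrite qfactS (_ : n - k.+1 + 1 = (n - k.+1).+1)%N; last by lia.
rewrite (_ : n - k = (n - k.+1).+1)%N; last by lia.
rewrite qfactS.
have := qfact_neq0 q1 k; have := qfact_neq0 q1 (n - k.+1).
have := q1 k; have := q1 (n - k.+1) => *.
have : 1 - q ^+ k.+1 != 0 by rewrite -opprB oppr_eq0 q1.
move=> *; field; do ?[apply/andP; split] => //.
Qed.

(** [T] and [T'] are the closed forms of [msum N n] and [msum N.-1 n.-1] for n = N + k. Their ratio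
    q^N (1 + q^n) reduces the claim to an identity of rational functions in x, q^N and q^k. *)
Lemma PhiC_msum (N k : nat) (l : int) (x T T' : K) :
  (0 < k)%N -> x = q ^ l -> q ^+ (N + k) + 1 != 0 ->
  T = q ^+ 'C(N.+1, 2) * \prod_(i < N) (1 + q ^+ (k + i.+1)) ->
  ((0 < N)%N -> T' = q ^+ 'C(N, 2) * \prod_(i < N.-1) (1 + q ^+ (k + i.+1))) ->
  PhiC q (N + k) k l = qbinom q (N + k) k *
    (x * T + ((x ^+ 2 - x) + (1 - x) * q ^+ (N + k + (N + k)))
             * ((q ^+ N - 1) / (q ^+ (N + k) - 1) * T')).
Proof.
move=> k0 xE n1 TE T'E; rewrite /PhiC /Delta; case: eqP => [|_]; first by lia.
rewrite Ybinom_qbinom; last by lia.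
rewrite (_ : N + k - k = N)%N; last by lia.
rewrite big_add1 big_mkord addn1.
have x2 : q ^ (2 * l) = x ^+ 2 by rewrite xE exprnP exprz_exp mulrC.
have -> : q ^ (2 * l - (N + k)%N%:Z + k%:Z) = x ^+ 2 / q ^+ N.
  rewrite -x2 (_ : 2 * l - (N + k)%N%:Z + k%:Z = 2 * l + - N%:Z); last by lia.
  by rewrite expfzDr // -exprnN.
have -> : q ^ (l - (N + k)%N%:Z + k%:Z) = x / q ^+ N.
  rewrite xE (_ : l - (N + k)%N%:Z + k%:Z = l + - N%:Z); last by lia.
  by rewrite expfzDr // -exprnN.
have -> : q ^ (l + (N + k)%N%:Z + k%:Z) = x * q ^+ N * q ^+ k * q ^+ k.
  by rewrite xE !expfzDr // -!exprnP exprD !mulrA.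
rewrite x2 -xE.
have -> : (2 * (N + k) = (N + k) + (N + k))%N by lia.
have nn1 : q ^+ (N + k) - 1 != 0.
  by rewrite (_ : N + k = (N + k).-1.+1)%N ?q1 //; lia.
set Q := qbinom q (N + k) k.
have qN := expf_neq0 N q0.
have nm1 : q ^+ (N + k + (N + k)) - 1 != 0.
  rewrite exprD (_ : _ - 1 = (q ^+ (N + k) - 1) * (q ^+ (N + k) + 1)) ?mulf_neq0 //.
  by ring.
have TT' : (0 < N)%N -> T = T' * (q ^+ N * (1 + q ^+ (N + k))).
  case: N TE T'E {n1 Q nn1 qN nm1} => // N TE T'E _.
  rewrite TE T'E // big_ord_recr /= [in LHS]binS bin1 exprD (addnC k).
  by ring.
have {}TE : T = \prod_(i < N) (1 + q ^+ (k + i.+1)) * q ^+ 'C(N.+1, 2) by rewrite mulrC.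
transitivity (T * Q / (q ^+ (N + k + (N + k)) - 1) *
   (x ^+ 2 - x ^+ 2 / q ^+ N + x * q ^+ N * q ^+ k * q ^+ k - 2 * x + x / q ^+ N +
    q ^+ (N + k + (N + k)) - q ^+ (N + k + k))).
  by rewrite TE.
(* For [N = 0] nothing is known about [T'], but its coefficient q^N - 1 vanishes. *)
case: (posnP N) => [N0|N_gt0].
  rewrite N0 !add0n expr0 subrr mul0r mul0r mulr0 addr0 in nm1 *.
  by rewrite !exprD in nm1 *; field; rewrite oner_neq0.
move: nn1 nm1 n1 qN; rewrite (TT' N_gt0) !exprD => nn1 nm1 n1 qN; field.
by rewrite nn1 qN nm1.
Qed.

(* [p0] and [p2] are the proportions of the lattices of type [(a, b)] with
   [delta_n = 0], resp. [2]. *)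
Lemma PhiC_sum (n k : nat) (l : int) (S : nat -> K) (W : nat -> nat -> K) :
  (0 < k <= n)%N -> q ^+ n + 1 != 0 ->
  (forall M, \sum_(m < M.+1) qbinom q M m * S m = q ^+ 'C(M.+1, 2)) ->
  (forall a b, (a + b <= n)%N ->
     let u := q ^ (- l) in
     let p0 := q ^- b * (q ^+ (n - a - b) - 1) / (q ^+ n - 1) in
     let p2 := (q ^+ n - q ^+ n / q ^+ b) / (q ^+ n - 1) in
     W a b = q ^+ (b * (n - a - b)) * (qbinom q n (a + b) * qbinom q (a + b) a) *
       (p0 + u * (1 - p0 - p2) + u ^+ 2 * p2)) ->
  PhiC q n k l = q ^ (2 * l) * \sum_(k <= a < n.+1) \sum_(0 <= b < (n - a).+1)
    q ^+ (b * (a + b + 1)) * (W a b * (qbinom q a (a - k) * S (a - k)%N)).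
Proof.
move=> /andP[k0 kn] n1 hS WE.
have [N nE] : exists N, n = (N + k)%N by exists (n - k)%N; lia.
pose x := q ^ l.
have x0 : x != 0 by rewrite expfz_neq0.
have nn1 : q ^+ n - 1 != 0 by rewrite (_ : n = n.-1.+1)%N ?q1 //; lia.
(* With a = m + k, these are [p0] and [p2] cleared of the denominator q^n - 1. *)
pose P0 m b := q ^- b * (q ^+ (N - m - b) - 1).
pose P2 (b : nat) := q ^+ n - q ^+ n / q ^+ b.
pose M m b := q ^+ (b * n.+1) * qmulti q N m b * S m.
(* The value 0 at [N = 0] is arbitrary: [T'] always comes with the factor q^N - 1. *)
pose T' := if N is N'.+1 then msum q N' n.-1 S else 0.
have s0 : \sum_(m < N.+1) \sum_(b < N.+1) M m b * P0 m b = (q ^+ N - 1) * T'.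
  rewrite /T' /M /P0; case: N {P0 M T'} nE => [|N] nE; last by apply: sum_qmulti_r => //; lia.
  by rewrite !big_ord1 /= !subnn subrr !mulr0.
have s2 : \sum_(m < N.+1) \sum_(b < N.+1) M m b * P2 b = (q ^+ N - 1) * q ^+ (n + n) * T'.
  rewrite /T' /M /P2; case: N {P0 M T' s0} nE => [|N] nE; last by apply: sum_qmulti_l => //; lia.
  by rewrite !big_ord1 /= expr0 divr1 subrr !mulr0.
have s1 : \sum_(m < N.+1) \sum_(b < N.+1) M m b = msum q N n S by [].
have TE : msum q N n S = q ^+ 'C(N.+1, 2) * \prod_(i < N) (1 + q ^+ (k + i.+1)).
  by rewrite nE msumE.
have T'E : (0 < N)%N -> T' = q ^+ 'C(N, 2) * \prod_(i < N.-1) (1 + q ^+ (k + i.+1)).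
  rewrite /T'; case: N {P0 M T' s0 s1 s2 TE} nE => // N nE _.
  by rewrite nE addSn /= msumE.
transitivity (qbinom q n k * (x * msum q N n S + ((x ^+ 2 - x) + (1 - x) * q ^+ (n + n))
             * ((q ^+ N - 1) / (q ^+ n - 1) * T'))).
  by rewrite nE; apply: PhiC_msum => //; rewrite -?nE.
(* Since u = x^(-1), x^2 (p0 + u (1 - p0 - p2) + u^2 p2) = x + (x^2 - x) p0 + (1 - x) p2. *)
rewrite [RHS](_ : _ = qbinom q n k * \sum_(m < N.+1) \sum_(b < N.+1)
  (x * M m b + (x ^+ 2 - x) / (q ^+ n - 1) * (M m b * P0 m b)
   + (1 - x) / (q ^+ n - 1) * (M m b * P2 b))); last first.
  rewrite (big_addn 0 _ k) subSn // (_ : n - k = N)%N; last by lia.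
  rewrite big_mkord !mulr_sumr; apply: eq_bigr => -[m /=]; rewrite ltnS => mN _.
  rewrite big_mkord (_ : n - (m + k) = N - m)%N; last by lia.
  rewrite [in RHS](@big_ord_trunc _ (N - m).+1 _ (fun b => x * M m b
    + (x ^+ 2 - x) / (q ^+ n - 1) * (M m b * P0 m b)
    + (1 - x) / (q ^+ n - 1) * (M m b * P2 b))) ?ltnS ?leq_subr //; last first.
    by move=> b bN; rewrite /M qmulti_small ?(mulr0, mul0r) ?addr0 //; lia.
  rewrite !mulr_sumr; apply: eq_bigr => -[b /=]; rewrite ltnS => bN _.
  rewrite addnK WE /=; last by lia.
  have x2 : q ^ (2 * l) = x ^+ 2 by rewrite /x exprnP exprz_exp mulrC.
  rewrite x2 -/x -invr_expz -/x.
  have -> : q ^+ (b * (m + k + b + 1)) =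
      q ^+ (b * n.+1) / q ^+ (b * (n - (m + k) - b)).
    rewrite -[LHS](mulfK (expf_neq0 (b * (n - (m + k) - b)) q0)) -exprD.
    by congr (q ^+ _ / _); nia.
  have -> : (n - (m + k) - b = N - m - b)%N by lia.
  (* With a = m + k, [n; a, b] [a choose m] = [n choose k] [N; m, b]: both are the q-multinomial
     with lower entries k, m, b, N-m-b. *)
  rewrite /M /P0 /P2 qmultiE // ?qbinomE //; try lia.
  rewrite (_ : n - (m + k + b) = N - m - b)%N; last by lia.
  rewrite (_ : m + k + b - (m + k) = b)%N; last by lia.
  rewrite (_ : n - k = N)%N; last by lia.
  rewrite (_ : m + k - m = k)%N; last by lia.
  have := qfact_neq0 q1 m; have := qfact_neq0 q1 b; have := qfact_neq0 q1 (N - m - b).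
  have := qfact_neq0 q1 N; have := qfact_neq0 q1 k; have := qfact_neq0 q1 (m + k).
  have := qfact_neq0 q1 (m + k + b); have := expf_neq0 b q0.
  have := expf_neq0 (b * (N - m - b)) q0 => *.
  by field; do ?[apply/andP; split].
have -> : \sum_(m < N.+1) \sum_(b < N.+1)
  (x * M m b + (x ^+ 2 - x) / (q ^+ n - 1) * (M m b * P0 m b)
   + (1 - x) / (q ^+ n - 1) * (M m b * P2 b)) =
   x * msum q N n S + (x ^+ 2 - x) / (q ^+ n - 1) * ((q ^+ N - 1) * T')
   + (1 - x) / (q ^+ n - 1) * ((q ^+ N - 1) * q ^+ (n + n) * T').
  rewrite -s1 -s0 -s2 !mulr_sumr -!big_split; apply: eq_bigr => m _ /=.
  by rewrite !mulr_sumr -!big_split.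
by field.
Qed.

End Phi.

(* A surjection onto [(o/p)^a (+) (o/p^2)^b] is recorded by its reduction modulo
   [pi], together with the second [pi]-adic digits of its last [b] columns. *)
Definition full_keys (F : finFieldType) (a b n : nat) :
    {set 'M[F]_(n, a + b) * 'M[F]_(n, b)} :=
  [set p | row_full p.1].

(** An endomorphism sends (o/p)^a into the part of (o/p^2)^b killed by p, so the leading digits of
    the upper right block vanish; invertibility is read off modulo [pi]. *)
Definition aut_keys (F : finFieldType) (a b : nat) :
    {set 'M[F]_(a + b) * 'M[F]_(a + b, b)} :=
  [set p | row_full p.1 && (ursubmx p.1 == 0)].

(** * Counting surjections and automorphisms by their digits *)

Section KeyCounts.
Variable F : finFieldType.
Local Notation q := #|F|.
Local Notation Y := (q%:R : rat).

Lemma card_row_free_submx (r n m : nat) (V : 'M[F]_(m, n)) :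
  #|[set A : 'M[F]_(r, n) | row_free A && (A <= V)%MS]%SET|%:R
  = \prod_(i < r) (Y ^+ \rank V - Y ^+ i).
Proof.
have := @card_sub_flag F 0 r n m V; rewrite big_ord0 mulr1 => <-.
congr (_%:R); apply: eq_card => A; rewrite !inE.
rewrite (_ : dsubmx (A : 'M_(0 + r, n)) = A) //.
by apply/matrixP => i j; rewrite mxE; congr (A _ _); apply: val_inj.
Qed.

Lemma card_trmx (m n : nat) (P : pred 'M[F]_(m, n)) :
  #|[set A | P A]%SET| = #|[set A | P A^T]%SET|.
Proof.
rewrite -(card_imset _ (@trmx_inj F n m)); apply: eq_card => A; rewrite !inE.
apply/idP/imsetP => [PA|[B]]; last by rewrite inE => PB ->.
by exists A^T; rewrite ?inE trmxK.
Qed.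

Lemma row_full_trmx (m n : nat) (A : 'M[F]_(m, n)) : row_full A^T = row_free A.
Proof. by rewrite /row_full /row_free mxrank_tr. Qed.

(** Turns a condition on the last row into membership of the transposed rows in a hyperplane, where
    the flag counts apply. *)
Lemma sub_last_col_ker (m n : nat) (A : 'M[F]_(m, n.+1)) :
  (A <= kermx (delta_mx ord_max 0 : 'cV_n.+1))%MS = (row ord_max A^T == 0).
Proof. by rewrite sub_kermx -colE -(inj_eq trmx_inj) tr_col trmx0. Qed.

Lemma rank_last_col_ker (n : nat) :
  \rank (kermx (delta_mx ord_max 0 : 'M[F]_(n.+1, 1))) = n.
Proof. by rewrite mxrank_ker mxrank_delta subn1. Qed.

Lemma card_last_row0 (n b : nat) :
  #|[set C : 'M[F]_(n.+1, b) | row ord_max C == 0]%SET| = (q ^ (n * b))%N.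
Proof.
pose f (D : 'M[F]_(n, b)) : 'M[F]_(n.+1, b) :=
  \matrix_(i, j) (if unlift ord_max i is Some k then D k j else 0).
have fK : cancel f (row' ord_max).
  by move=> D; apply/matrixP => i j; rewrite !mxE liftK.
rewrite -card_mx -cardsT -(card_imset _ (can_inj fK)); apply: eq_card => C; rewrite !inE.
apply/eqP/imsetP => [C0|[D _ ->]]; last by apply/rowP => j; rewrite !mxE unlift_none.
exists (row' ord_max C) => //; apply/matrixP => i j; rewrite !mxE.
case: unliftP => [k ->|->]; rewrite ?mxE //.
by have /rowP/(_ j) := C0; rewrite !mxE.
Qed.

Lemma card_full_keys (n a b : nat) :
  #|full_keys F a b n|%:R = Y ^+ (n * b) * frames Y n (a + b).
Proof.
have -> : full_keys F a b n =
    finset.setX [set B : 'M[F]_(n, a + b) | row_full B]%SET [set: 'M[F]_(n, b)]%SET.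
  by apply/setP => -[B C]; rewrite !inE andbT.
rewrite cardsX cardsT card_mx natrM natrX mulrC; congr (_ * _).
rewrite card_trmx; under eq_finset do rewrite row_full_trmx.
exact: card_row_free.
Qed.

Lemma card_full_keys_le1 (n a b : nat) :
  #|[set p in full_keys F a b n.+1 | rsubmx (row ord_max p.1) == 0]%SET|%:R
  = Y ^+ (n.+1 * b) * (frames Y n b * \prod_(i < a) (Y ^+ n.+1 - Y ^+ (b + i))).
Proof.
have -> : [set p in full_keys F a b n.+1 | rsubmx (row ord_max p.1) == 0]%SET =
    finset.setX [set B : 'M[F]_(n.+1, a + b) | row_full B && (rsubmx (row ord_max B) == 0)]%SET
         [set: 'M[F]_(n.+1, b)]%SET.
  by apply/setP => -[B C]; rewrite !inE andbT.
rewrite cardsX cardsT card_mx natrM natrX mulrC; congr (_ * _).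
rewrite card_trmx; pose V := kermx (delta_mx ord_max 0 : 'M[F]_(n.+1, 1)).
under eq_finset => A.
  rewrite row_full_trmx (_ : rsubmx _ = row ord_max (dsubmx A)^T); last first.
    by apply/rowP => j; rewrite !mxE.
  rewrite -sub_last_col_ker; over.
by rewrite card_sub_flag rank_last_col_ker.
Qed.

Lemma card_full_keys_eq0 (n a b : nat) :
  #|[set p in full_keys F a b n.+1 |
      (row ord_max p.1 == 0) && (row ord_max p.2 == 0)]%SET|%:R
  = Y ^+ (n * b) * frames Y n (a + b).
Proof.
have -> : [set p in full_keys F a b n.+1 |
      (row ord_max p.1 == 0) && (row ord_max p.2 == 0)]%SET =
    finset.setX [set B : 'M[F]_(n.+1, a + b) | row_full B && (row ord_max B == 0)]%SET
         [set C : 'M[F]_(n.+1, b) | row ord_max C == 0]%SET.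
  by apply/setP => -[B C]; rewrite !inE andbA.
rewrite cardsX card_last_row0 natrM natrX mulrC; congr (_ * _).
rewrite card_trmx.
under eq_finset do rewrite row_full_trmx -sub_last_col_ker.
by rewrite card_row_free_submx rank_last_col_ker.
Qed.

(** After transposition, the vanishing block says that the last [b] rows lie in the span of the last
    [b] coordinates. *)
Lemma card_aut_keys (a b : nat) :
  #|aut_keys F a b|%:R
  = Y ^+ ((a + b) * b) * (frames Y b b * \prod_(i < a) (Y ^+ (a + b) - Y ^+ (b + i))).
Proof.
have -> : aut_keys F a b =
    finset.setX [set B : 'M[F]_(a + b) | row_full B && (ursubmx B == 0)]%SET
         [set: 'M[F]_(a + b, b)]%SET.
  by apply/setP => -[B C]; rewrite !inE andbT.
rewrite cardsX cardsT card_mx natrM natrX mulrC; congr (_ * _).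
rewrite card_trmx; pose V : 'M[F]_(b, a + b) := row_mx 0 1%:M.
have rV : \rank V = b.
  apply/eqP; rewrite -/(row_free V); apply/row_freeP; exists (col_mx 0 1%:M).
  by rewrite mul_row_col mul0mx add0r mulmx1.
under eq_finset => A.
  rewrite row_full_trmx (_ : (_ == 0) = (dsubmx A <= V)%MS); last first.
    rewrite -trmx_dlsub -(inj_eq trmx_inj) trmxK trmx0.
    apply/eqP/submxP => [A0|[X dA]].
      exists (rsubmx (dsubmx A)); rewrite mul_mx_row mulmx0 mulmx1.
      by rewrite -[LHS]hsubmxK -[lsubmx _]/(dlsubmx A) A0.
    by rewrite /dlsubmx dA mul_mx_row mulmx0 row_mxKl.
  over.
by rewrite card_sub_flag rV.
Qed.

Lemma qbase_neq0 : Y != 0.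
Proof. by rewrite pnatr_eq0 -lt0n ltnW // card_finNzRing_gt1. Qed.

Lemma qbase_exp_neq1 n : Y ^+ n.+1 - 1 != 0.
Proof. by rewrite subr_eq0 gt_eqF // exprn_egt1 // ltr1n card_finNzRing_gt1. Qed.

Lemma card_sym_qbinom (a r : nat) : (r <= a)%N ->
  (card_sym F a r)%:R = qbinom Y a r * card_sym_unit F r.
Proof.
move=> ra; have f0 := frames_self_neq0 qbase_neq0 qbase_exp_neq1 r.
apply: (mulIf f0); have := card_sym_congr F a r; rewrite !card_row_free => ->.
rewrite -/(frames Y a r) frames_qbinom //; first by rewrite mulrAC.
  exact: qbase_neq0.
exact: qbase_exp_neq1.
Qed.

Lemma sum_qbinom_sym_unit (m : nat) :
  \sum_(r < m.+1) qbinom Y m r * card_sym_unit F r = Y ^+ 'C(m.+1, 2).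
Proof.
rewrite -natrX -sum_card_sym natr_sum; apply: eq_bigr => r _.
by rewrite card_sym_qbinom // -ltnS.
Qed.

(** The weight q^(-i) cancels the value of x_i for every variable but the last, which keeps
    q^(-l). *)
Lemma psi_delta (n : nat) (l : int) (d : 'I_n.+1 -> nat) :
  psi l q (\prod_(i < n.+1) ((Y ^- i.+1) *: 'X_(lift ord0 i)) ^+ d i) =
  (Y ^ (- l)) ^+ d ord_max.
Proof.
have Y0 := qbase_neq0.
rewrite /psi rmorph_prod big_ord_recr /= big1 => [|i _].
  rewrite mul1r rmorphXn /= mevalZ mevalXU /= /bump leq0n add1n eqxx; congr (_ ^+ _).
  by rewrite expfzDr // mulKf // expf_neq0.
rewrite rmorphXn /= mevalZ mevalXU /= /bump leq0n add1n eqSS (ltn_eqF (ltn_ord i)).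
by rewrite mulVf ?expr1n // expf_neq0.
Qed.

End KeyCounts.

Local Open Scope classical_set_scope.
Local Open Scope ring_scope.

(** * Lattices as kernels of matrices *)

Section PowerIdeals.
Variables (o : idomainType) (pi : o).

Lemma pidealP m x : pideal pi m x <-> exists y, x = pi ^+ m * y.
Proof. by split=> [[y _ <-]|[y ->]]; exists y. Qed.

Lemma pideal0 m : pideal pi m 0.
Proof. by apply/pidealP; exists 0; rewrite mulr0. Qed.

Lemma pidealB m x y : pideal pi m x -> pideal pi m y -> pideal pi m (x - y).
Proof.
by move=> /pidealP[x' ->] /pidealP[y' ->]; apply/pidealP; exists (x' - y'); rewrite mulrBr.
Qed.

Lemma pidealD m x y : pideal pi m x -> pideal pi m y -> pideal pi m (x + y).
Proof.
by move=> /pidealP[x' ->] /pidealP[y' ->]; apply/pidealP; exists (x' + y'); rewrite mulrDr.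
Qed.

Lemma pidealMl m x y : pideal pi m y -> pideal pi m (x * y).
Proof. by move=> /pidealP[y' ->]; apply/pidealP; exists (x * y'); rewrite mulrCA. Qed.

Lemma pideal_sum m (I : finType) (f : I -> o) :
  (forall i, pideal pi m (f i)) -> pideal pi m (\sum_i f i).
Proof.
move=> fP; elim/big_ind: _ => // [|x y]; [exact: pideal0|exact: pidealD].
Qed.

Definition rows_type_sub (a b m : nat) (A : 'M[o]_(m, a + b)) : Prop :=
  (forall i j, pideal pi 1 (A i (lshift b j))) /\
  (forall i j, pideal pi 2 (A i (rshift a j))).

Section TypeSub.
Variables a b : nat.
Local Notation T := (@rows_type_sub a b _).

Lemma type_subE (v : 'rV[o]_(a + b)) : type_sub pi v <-> T v.
Proof.
split=> [[H1 H2]|[H1 H2]]; split=> //; first by move=> i; rewrite ord1; apply: H1.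
by move=> i; rewrite ord1; apply: H2.
Qed.

Lemma rtsB m (A B : 'M[o]_(m, a + b)) : T A -> T B -> T (A - B).
Proof. by move=> [A1 A2] [B1 B2]; split=> i j; rewrite !mxE; apply: pidealB. Qed.

Lemma rtsD m (A B : 'M[o]_(m, a + b)) : T A -> T B -> T (A + B).
Proof. by move=> [A1 A2] [B1 B2]; split=> i j; rewrite !mxE; apply: pidealD. Qed.

Lemma rtsM m p (X : 'M[o]_(p, m)) (A : 'M[o]_(m, a + b)) : T A -> T (X *m A).
Proof.
by move=> [A1 A2]; split=> i j; rewrite !mxE; apply: pideal_sum => k; apply: pidealMl.
Qed.

Lemma rts_pi2 m (A : 'M[o]_(m, a + b)) : T (pi ^+ 2 *: A).
Proof.
split=> i j; rewrite !mxE; apply/pidealP; last by exists (A i (rshift a j)).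
by exists (pi * A i (lshift b j)); rewrite expr2 mulrA.
Qed.

Lemma rts_rows m (A : 'M[o]_(m, a + b)) :
  (forall v : 'rV_m, T (v *m A)) <-> T A.
Proof.
split=> [H|H v]; last exact: rtsM.
by split=> i j; have := H (delta_mx 0 i); rewrite -rowE => -[H1 H2];
  [have := H1 0 j|have := H2 0 j]; rewrite mxE.
Qed.

Lemma rts_subr m (A B : 'M[o]_(m, a + b)) : T (A - B) -> T A <-> T B.
Proof.
move=> AB; split=> H; last by rewrite -(subrK B A); apply: rtsD.
by rewrite -(subKr A B); apply: rtsB.
Qed.

(** The kernel of the map from o^n to (o/p)^a (+) (o/p^2)^b with matrix [A]. *)
Definition lat (n : nat) (A : 'M[o]_(n, a + b)) : set 'rV[o]_n :=
  [set v | T (v *m A)].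

Lemma lat_mul n m (A B : 'M[o]_(n, a + b)) (X : 'M[o]_(m, n)) :
  lat A `<=` lat B -> T (X *m A) -> T (X *m B).
Proof.
move=> AB TA; apply/rts_rows => v; rewrite mulmxA; apply: AB.
by rewrite /lat /= -mulmxA; apply: rtsM.
Qed.

Lemma lat_congr n (A B : 'M[o]_(n, a + b)) : T (A - B) -> lat A = lat B.
Proof.
move=> AB; have P (v : 'rV_n) : T (v *m A - v *m B) by rewrite -mulmxBr; apply: rtsM.
by apply/seteqP; split=> v; [move=> /(rts_subr (P v))|move=> H; apply/(rts_subr (P v))].
Qed.

Lemma lat_submodule n (A : 'M[o]_(n, a + b)) : submodule (lat A).
Proof.
split; first by rewrite /lat /= mul0mx; split=> i j; rewrite mxE; apply: pideal0.
  by move=> u v Tu Tv; rewrite /lat /= mulmxDl; apply: rtsD.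
by move=> c v Tv; rewrite /lat /= -scalemxAl -mul_scalar_mx; apply: rtsM.
Qed.

End TypeSub.
End PowerIdeals.

(** * Finite quotients and their indices *)

Section Index.
Variables (o : idomainType).

Lemma surj_card_le (V : Type) (X Y : finType) (f : V -> X) (g : V -> Y) :
  (forall x, exists v, f v = x) -> (forall v w, g v = g w -> f v = f w) ->
  (#|X| <= #|Y|)%N.
Proof.
move=> f_surj gf; have [s sP] := choice f_surj.
by apply: (@leq_card _ _ (g \o s)) => x y /= /gf; rewrite !sP.
Qed.

Lemma coset_eq (V : lmodType o) (L : set V) x y : submodule L ->
  [set x + v | v in L] = [set y + v | v in L] <-> L (x - y).
Proof.
move=> [L0 LD LZ]; have LN v : L v -> L (- v) by rewrite -scaleN1r; apply: LZ.
split=> [E|Lxy].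
  have : [set x + v | v in L] x by exists 0; rewrite ?addr0.
  by rewrite E => -[v Lv <-]; rewrite addrC addKr.
apply/seteqP; split=> _ [v Lv <-].
  by exists ((x - y) + v); [apply: LD|rewrite addrA (addrC y) subrK].
exists (- (x - y) + v); first by apply: LD => //; apply: LN.
by rewrite opprB addrA (addrC x) subrK.
Qed.

Lemma mod_index_map (V : lmodType o) (L : set V) :
  submodule L -> finite_set (cosets L) ->
  exists f : V -> 'I_(mod_index L),
    (forall i, exists v, f v = i) /\ (forall x y, f x = f y <-> L (x - y)).
Proof.
move=> sL fL; set C := fset_set (cosets L).
have CP x : [set x + v | v in L] \in C by rewrite in_fset_set // inE; exists x.
have EC : #|{: C}| = mod_index L by rewrite /mod_index -cardfE.
exists (fun x => cast_ord EC (enum_rank [` CP x]%fset)); split=> [i|x y].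
  pose c := enum_val (cast_ord (esym EC) i).
  have : val c \in C by exact: valP.
  rewrite in_fset_set // inE => -[x _ xE]; exists x.
  rewrite (_ : [` CP x]%fset = c) ?enum_valK ?cast_ordKV //.
  exact: val_inj.
rewrite -(coset_eq _ _ sL); split=> [/cast_ord_inj/enum_rank_inj/(congr1 val) //|E].
by congr cast_ord; congr enum_rank; apply: val_inj.
Qed.

Lemma finite_cosets (V : lmodType o) (L : set V) (Y : finType) (f : V -> Y) :
  submodule L -> (forall x y, f x = f y -> L (x - y)) -> finite_set (cosets L).
Proof.
move=> sL fP; pose c y := xget set0 [set C | exists2 x, f x = y & C = [set x + v | v in L]].
apply: (sub_finite_set (B := range c)); last by apply: finite_image; apply: finite_finset.
move=> _ [x _ <-]; exists (f x) => //; rewrite /c.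
set S := [set C | _]; have : S (xget set0 S) by apply: xgetPex; eexists; exists x.
by case=> y fy ->; apply/coset_eq => //; apply: fP.
Qed.

End Index.

(** * Expansions in powers of the uniformizer *)

Section Keys.
Variables (o : idomainType) (pi : o) (F : finFieldType) (red : {rmorphism o -> F}).
Hypotheses (pi_neq0 : pi != 0) (redP : forall x, red x = 0 <-> pideal pi 1 x).
Hypothesis red_unit : forall x, red x != 0 -> x \is a GRing.unit.
Variables (sec : F -> o) (dv : o -> o).
Hypotheses (secK : cancel sec red) (dvE : forall x, x = sec (red x) + pi * dv x).

Lemma red_pi : red pi = 0.
Proof. by apply/redP/pidealP; exists 1; rewrite mulr1. Qed.

Lemma pideal1P x y : pideal pi 1 (x - y) <-> red x = red y.
Proof.
by rewrite -redP rmorphB; split=> [/eqP|->]; rewrite ?subrr // subr_eq0 => /eqP.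
Qed.

(** [sec] picks a representative of each residue and [dv] strips off the leading digit, so
    congruences can be tested digit by digit. *)
Lemma pidealSP m x y :
  pideal pi m.+1 (x - y) <-> red x = red y /\ pideal pi m (dv x - dv y).
Proof.
have E : red x = red y -> x - y = pi * (dv x - dv y).
  by move=> rxy; rewrite {1}(dvE x) {1}(dvE y) rxy; ring.
split=> [/pidealP[z zE]|[rxy /pidealP[z zE]]]; last first.
  by apply/pidealP; exists z; rewrite E // zE exprS mulrA.
have rxy : red x = red y.
  by apply/pideal1P; apply/pidealP; exists (pi ^+ m * z); rewrite zE exprS mulrA.
split=> //; apply/pidealP; exists z; apply: (mulfI pi_neq0).
by rewrite -E // zE exprS mulrA.
Qed.

Lemma pideal2P x y :
  pideal pi 2 (x - y) <-> red x = red y /\ red (dv x) = red (dv y).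
Proof. by rewrite pidealSP pideal1P. Qed.

Lemma dv_sec u x : dv (sec u + pi * x) = x.
Proof.
have := dvE (sec u + pi * x).
rewrite rmorphD rmorphM red_pi mul0r addr0 secK => /addrI/(mulfI pi_neq0) //.
Qed.

(** The first [d] digits form a model of o/p^d. *)
Lemma pideal_map d : exists (X : finType) (f : o -> X),
  [/\ #|X| = (#|F| ^ d)%N, forall i, exists x, f x = i
    & forall x y, f x = f y <-> pideal pi d (x - y)].
Proof.
elim: d => [|d [X [f [X_card f_surj fP]]]].
  exists unit, (fun=> tt); split=> [|[]|x y]; [exact: card_unit|by exists 0|].
  by split=> // _; apply/pidealP; exists (x - y); rewrite mul1r.
exists (F * X)%type, (fun x => (red x, f (dv x))); split=> [|[u i]|x y].
- by rewrite card_prod X_card expnS.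
- have [x <-] := f_surj i; exists (sec u + pi * x).
  by rewrite dv_sec rmorphD rmorphM red_pi mul0r addr0 secK.
- by rewrite pidealSP -fP; split=> [[-> ->]|[-> ->]].
Qed.

(* [delta_n] is the exponent [d] such that the image of the last basis vector
   in the quotient by [L] has annihilator [pi ^ d]. *)
Lemma mod_index_proj n (L : set 'rV[o]_n.+1) d :
  submodule L -> finite_set (cosets L) ->
  (forall x, L (x *: delta_mx 0 ord_max) <-> pideal pi d x) ->
  mod_index L = (mod_index (proj_first (leqnSn n) @` L) * #|F| ^ d)%N.
Proof.
move=> sL fL dP; set w := proj_first (leqnSn n); have [L0 LD LZ] := sL.
have wB x y : w (x - y) = w x - w y by apply/rowP => j; rewrite !mxE.
have wZ c x : w (c *: x) = c *: w x by apply/rowP => j; rewrite !mxE.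
have wD x y : w (x + y) = w x + w y by apply/rowP => j; rewrite !mxE.
have we c : w (c *: delta_mx 0 ord_max) = 0.
  apply/rowP => j; rewrite !mxE (_ : (widen_ord (leqnSn n) j == ord_max) = false) ?andbF ?mulr0 //.
  by apply/eqP => /(congr1 val) /= jn; have := ltn_ord j; rewrite jn ltnn.
have wK x : w x = 0 -> exists c, x = c *: delta_mx 0 ord_max.
  move=> wx; exists (x 0 ord_max); apply/rowP => j; rewrite !mxE.
  have [->|jn] := eqVneq j ord_max; first by rewrite mulr1.
  have jltn : (j < n)%N.
    by rewrite ltn_neqAle -ltnS ltn_ord andbT; apply: contra jn => /eqP E; apply/eqP/val_inj.
  have /rowP/(_ (Ordinal jltn)) := wx; rewrite !mxE mulr0 => <-.
  by congr (x _ _); apply: val_inj.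
have w_surj y : exists x, w x = y.
  exists (\row_(j < n.+1) (if insub (val j) is Some i then y 0 i else 0)).
  by apply/rowP => j; rewrite !mxE /= valK.
have swL : submodule (w @` L).
  split; first by exists 0 => //; rewrite -(subrr 0) wB subrr.
    by move=> _ _ [u Lu <-] [v Lv <-]; exists (u + v); [apply: LD|rewrite wD].
  by move=> c _ [v Lv <-]; exists (c *: v); [apply: LZ|rewrite wZ].
have fwL : finite_set (cosets (w @` L)).
  apply: (sub_finite_set (B := (fun C => w @` C) @` cosets L)); last exact: finite_image.
  move=> _ [y _ <-]; have [x <-] := w_surj y; exists [set x + v | v in L]; first by exists x.
  apply/seteqP; split=> [_ [_ [v Lv <-] <-]|_ [_ [v Lv <-] <-]].
    by exists (w v); [exists v|rewrite wD].
  by exists (x + v); [exists v|rewrite wD].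
have [f [f_surj fP]] := mod_index_map sL fL.
have [g [g_surj gP]] := mod_index_map swL fwL.
have [X [h [X_card h_surj hP]]] := pideal_map d.
have [s sP] : exists s : 'I_(mod_index (w @` L)) -> 'rV_n.+1, forall i, g (w (s i)) = i.
  have H i : exists x, g (w x) = i by have [y <-] := g_surj i; have [x <-] := w_surj y; exists x.
  by have [s sP] := choice H; exists s.
(* Modulo [L], a vector differs from the chosen lift of its projected class by a multiple [t x] of
   the last basis vector. *)
have [t tP] : exists t : 'rV_n.+1 -> o,
    forall x, L (x - s (g (w x)) - t x *: delta_mx 0 ord_max).
  have H x : exists c, L (x - s (g (w x)) - c *: delta_mx 0 ord_max).
    have /gP [v Lv] : g (w x) = g (w (s (g (w x)))) by rewrite sP.
    rewrite -wB => /eqP; rewrite eq_sym -subr_eq0 -wB => /eqP/wK[c E].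
    by exists c; rewrite -E subKr.
  by have [t tP] := choice H; exists t.
(* The projected class together with [t x] modulo [pi ^+ d] is a complete invariant modulo [L], and
   every pair of values occurs. *)
pose k x := (g (w x), h (t x)).
have LB u v : L u -> L v -> L (u - v).
  by move=> Lu Lv; apply: LD => //; rewrite -scaleN1r; apply: LZ.
have kP x y : k x = k y <-> L (x - y).
  have H : g (w x) = g (w y) -> h (t x) = h (t y) <-> L (x - y).
    move=> E; rewrite hP -dP.
    have := LB _ _ (tP x) (tP y); rewrite E.
    set e := delta_mx _ _; set z := s _.
    have -> : x - z - t x *: e - (y - z - t y *: e) = (x - y) - (t x - t y) *: e.
      rewrite scalerBl !opprB; apply/rowP => j; rewrite !mxE; ring.
    move=> Lxy; split=> H; first by rewrite -(subrK ((t x - t y) *: e) (x - y)); apply: LD.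
    by rewrite -(subKr (x - y) (_ *: e)); apply: LB.
  split=> [[E1 E2]|Lxy]; first exact/(H E1).
  have E : g (w x) = g (w y) by apply/gP; rewrite -wB; exists (x - y).
  by rewrite /k E; congr pair; apply/(H E).
have k_surj i : exists x, k x = i.
  case: i => i j; have [c <-] := h_surj j; pose x := s i + c *: delta_mx 0 ord_max.
  have wx : g (w x) = i by rewrite /x wD we addr0 sP.
  exists x; rewrite /k wx; congr pair; apply/hP/dP.
  have := tP x; rewrite wx {1}/x (addrC (s i)) addrK -scalerBl => /(LZ (-1)).
  by rewrite scalerA mulN1r opprB.
have fk x y : f x = f y <-> k x = k y by rewrite fP kP.
have := surj_card_le f_surj (fun x y => iffRL (fk x y)).
have := surj_card_le k_surj (fun x y => iffLR (fk x y)).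
by rewrite card_prod X_card !card_ord => le1 le2; apply/eqP; rewrite eqn_leq le1 le2.
Qed.

(** * Lattices of type [(a, b)] and the keys of their surjections *)

Section Shape.
Variables a b : nat.
Local Notation T := (@rows_type_sub o pi a b _).

Definition mx_key n (A : 'M[o]_(n, a + b)) : 'M[F]_(n, a + b) * 'M[F]_(n, b) :=
  (map_mx red A, map_mx (red \o dv) (rsubmx A)).

Definition mx_lift n (p : 'M[F]_(n, a + b) * 'M[F]_(n, b)) : 'M[o]_(n, a + b) :=
  map_mx sec p.1 + pi *: row_mx 0 (map_mx sec p.2).

Lemma mx_keyP n (A B : 'M[o]_(n, a + b)) : T (A - B) <-> mx_key A = mx_key B.
Proof.
split=> [[H1 H2]|[/matrixP H1 /matrixP H2]].
  congr pair; apply/matrixP => i j; rewrite !mxE.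
    apply/pideal1P; case: (split_ordP j) => k ->; have := H1; have := H2.
      by move=> _ /(_ i k); rewrite !mxE.
    by move=> /(_ i k) + _; rewrite !mxE => /pideal2P[/pideal1P].
  by have := H2 i j; rewrite !mxE => /pideal2P[].
split=> i j; rewrite !mxE; first by apply/pideal1P; have := H1 i (lshift b j); rewrite !mxE.
apply/pideal2P; split; first by have := H1 i (rshift a j); rewrite !mxE.
by have := H2 i j; rewrite !mxE.
Qed.

Lemma mx_liftK n : cancel (@mx_lift n) (@mx_key n).
Proof.
move=> [B C]; congr pair; apply/matrixP => i j; rewrite !mxE.
  by rewrite rmorphD rmorphM red_pi mul0r addr0 secK.
by have /= := unsplitK (inr _ j : 'I_a + 'I_b) => ->; rewrite mxE dv_sec secK.
Qed.

Lemma rts_red n (A : 'M[o]_(n, a + b)) : T A -> map_mx red A = 0.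
Proof.
move=> TA; have : T (A - 0) by rewrite subr0.
by move=> /mx_keyP[+ _]; rewrite map_mx0.
Qed.

(** One Newton step: if [X] satisfies X A = 1 + pi E1, then (1 - pi E1) X is a left inverse modulo
    pi^2. *)
Lemma row_full_inv n (A : 'M[o]_(n, a + b)) : row_full (map_mx red A) ->
  exists Y E, Y *m A = 1%:M + pi ^+ 2 *: E.
Proof.
move=> /row_fullP[B BA]; pose X := map_mx sec B.
have [E1 E1P] : exists E1, X *m A = 1%:M + pi *: E1.
  have H (ij : 'I_(a + b) * 'I_(a + b)) : exists y, (X *m A - 1%:M) ij.1 ij.2 = pi * y.
    case: ij => i j /=; have : red ((X *m A - 1%:M) i j) = 0.
      have /matrixP/(_ i j) : map_mx red (X *m A - 1%:M) = 0.
        rewrite map_mxB map_mxM map_mx1 (_ : map_mx red X = B) ?BA ?subrr //.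
        by apply/matrixP => k l; rewrite !mxE secK.
      by rewrite mxE => ->; rewrite mxE.
    by move=> /redP/pidealP[y ->]; exists y; rewrite expr1.
  have [e eP] := choice H; exists (\matrix_(i, j) e (i, j)).
  apply/eqP; rewrite addrC -subr_eq; apply/eqP/matrixP => i j.
  by rewrite (eP (i, j)) !mxE.
exists ((1%:M - pi *: E1) *m X), (- (E1 *m E1)).
rewrite -mulmxA E1P mulmxDr mulmx1 mulmxBl mul1mx -scalemxAl -scalemxAr scalerA -expr2.
by rewrite scalerN addrA subrK.
Qed.

(** The matrix of a surjection has the images of the basis vectors as rows; preimages of the basis
    of the target give a left inverse modulo [pi]. Conversely, [row_full_inv] provides preimages. *)
Lemma latticesE n :
  @lattices o pi n a b = @lat o pi a b n @` [set A | row_full (map_mx red A)].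
Proof.
apply/seteqP; split=> [L [[L0 LD LZ] [phi [phiL phiK phi_surj]]]|_ [A fA <-]].
  have TP v : type_sub pi v <-> T v by exact: type_subE.
  pose A := \matrix_(i < n) phi (delta_mx 0 i).
  (* [phi] is linear only modulo the target submodule, so [A] represents it only up to that
     submodule. *)
  have phiE v : T (phi v - v *m A).
    rewrite mulmx_sum_row {1}[v]row_sum_delta.
    elim: (index_enum _) => [|i s IH].
      by rewrite !big_nil subr0; apply/TP/phiK.
    rewrite !big_cons rowK.
    have /TP H := phiL (v 0 i) (delta_mx 0 i) (\sum_(j <- s) v 0 j *: delta_mx 0 j).
    by have := rtsD H IH; rewrite !opprD !addrA subrK.
  exists A.
    apply/row_fullP.
    have H (j : 'I_(a + b)) : exists v : 'rV_n, T (v *m A - delta_mx 0 j).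
      have [v /TP vP] := phi_surj (delta_mx 0 j); exists v.
      by have := rtsB vP (phiE v); rewrite opprB addrC addrA subrK.
    have [X XP] := choice H.
    exists (map_mx red (\matrix_j X j)); apply/row_matrixP => i.
    rewrite row_mul -map_row rowK row1 -map_mxM.
    apply/eqP; rewrite -(map_delta_mx red) -subr_eq0 -map_mxB; apply/eqP.
    exact: rts_red (XP i).
  apply/seteqP; split=> v; rewrite /lat /= => H.
    by apply/phiK/TP/(rts_subr (phiE v)).
  by apply/(rts_subr (phiE v))/TP/phiK.
have [Y [E YA]] := row_full_inv fA.
split; first exact: lat_submodule.
exists (fun v => v *m A); split.
- move=> c u v; apply/type_subE; rewrite mulmxDl -scalemxAl subrr.
  by split=> i j; rewrite mxE; apply: pideal0.
- by move=> v; rewrite type_subE.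
- move=> w; exists (w *m Y); apply/type_subE.
  rewrite -mulmxA YA mulmxDr mulmx1 addrC addKr -scalemxAr; exact: rts_pi2.
Qed.

Lemma mx_key_liftK n (A : 'M[o]_(n, a + b)) : T (mx_lift (mx_key A) - A).
Proof. by apply/mx_keyP; rewrite mx_liftK. Qed.

Lemma map_red_lift n (p : 'M[F]_(n, a + b) * 'M[F]_(n, b)) :
  map_mx red (mx_lift p) = p.1.
Proof. by have /(congr1 fst) := mx_liftK p. Qed.

Local Notation full_keys := (full_keys F a b).
Local Notation aut_keys := (aut_keys F a b).

(** The first [a] columns of [X] and the upper right block of [G] are both divisible by [pi], so
    their product is divisible by pi^2. *)
Lemma rts_lower m (G : 'M[o]_(a + b)) (X : 'M[o]_(m, a + b)) :
  ursubmx (map_mx red G) = 0 -> T X -> T (X *m G).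
Proof.
move=> G0 TX; have X0 := rts_red TX; case: TX => _ TX2.
have XG0 : map_mx red (X *m G) = 0 by rewrite map_mxM X0 mul0mx.
split=> i j; first by apply/redP; have /matrixP/(_ i (lshift b j)) := XG0; rewrite !mxE.
rewrite mxE big_split_ord /=; apply: pidealD; apply: pideal_sum => k; last first.
  by rewrite mulrC; apply: pidealMl.
have /redP/pidealP[x ->] : red (X i (lshift b k)) = 0.
  by have /matrixP/(_ i (lshift b k)) := X0; rewrite !mxE.
have /redP/pidealP[y ->] : red (G (lshift b k) (rshift a j)) = 0.
  by have /matrixP/(_ k j) := G0; rewrite !mxE.
by apply/pidealP; exists (x * y); ring.
Qed.

Lemma rts_aut g m (X : 'M[o]_(m, a + b)) :
  g \in aut_keys -> T (X *m mx_lift g) <-> T X.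
Proof.
rewrite inE => /andP[g1 /eqP g0].
have uG : mx_lift g \in unitmx.
  rewrite unitmxE; apply: red_unit.
  by rewrite -det_map_mx map_red_lift -unitfE -unitmxE -row_full_unit.
split; last by apply: rts_lower; rewrite map_red_lift.
(* The inverse also has a block lower triangular reduction, so [rts_lower] applies to it as well. *)
rewrite -{2}(mulmxK uG X); apply: rts_lower.
set H := map_mx red _; have : H *m g.1 = 1%:M.
  by rewrite -[g.1]map_red_lift -map_mxM mulVmx // map_mx1.
rewrite -[H]submxK -[g.1]submxK g0 mulmx_block !mulmx0 !add0r block_mxKur.
rewrite scalar_mx_block => /eq_block_mx[_ h2 _ /mulmx1C h4].
by rewrite -[LHS]mulmx1 -h4 mulmxA h2 mul0mx.
Qed.

(** Surjections with a common kernel differ by a unique automorphism of the target, acting by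
    multiplication on the right. *)
Lemma card_lat_fiber n (p0 : 'M[F]_(n, a + b) * 'M[F]_(n, b)) : p0 \in full_keys n ->
  #|[set p in full_keys n | `[< lat pi (mx_lift p) = lat pi (mx_lift p0) >]]%SET|
  = #|aut_keys|.
Proof.
rewrite inE => f0; set A := mx_lift p0.
have [Y [E YA]] : exists Y E, Y *m A = 1%:M + pi ^+ 2 *: E.
  by apply: row_full_inv; rewrite map_red_lift.
pose f g := mx_key (A *m mx_lift g).
have f_inj : {in aut_keys &, injective f}.
  move=> g g' _ _ fgg'; have /(rtsM Y) : T (A *m mx_lift g - A *m mx_lift g').
    exact/mx_keyP.
  rewrite -mulmxBr.
  rewrite mulmxA YA mulmxDl mul1mx => H.
  rewrite -[g]mx_liftK -[g']mx_liftK; apply/mx_keyP.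
  apply/(rts_subr
    (A := (mx_lift g - mx_lift g') + pi ^+ 2 *: E *m (mx_lift g - mx_lift g'))) => //.
  by rewrite addrC addKr -scalemxAl; apply: rts_pi2.
rewrite -(card_in_imset f_inj); apply: eq_card => p; rewrite !inE.
apply/andP/imsetP => [[fp /asboolP latE]|[g gA ->]].
  set A' := mx_lift p in latE.
  pose G := Y *m A'.
  (* The rows of A Y - 1 lie in the kernel of [A], hence in that of [A']. *)
  have TAG : T (A *m G - A').
    rewrite /G mulmxA -[X in _ - X]mul1mx -mulmxBl.
    apply: (@lat_mul _ _ _ _ _ _ A); first by rewrite latE.
    by rewrite mulmxBl -mulmxA YA mulmxDr mulmx1 mul1mx addrC addKr -scalemxAr; apply: rts_pi2.
  have redAG : p0.1 *m map_mx red G = p.1.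
    have /eqP := rts_red TAG; rewrite map_mxB map_mxM !map_red_lift subr_eq0.
    by move/eqP.
  exists (mx_key G); last first.
    rewrite -[LHS]mx_liftK -/A' /f.
    transitivity (mx_key (A *m G)); apply/esym/mx_keyP => //.
    by rewrite -mulmxBr; apply/rtsM/mx_key_liftK.
  rewrite inE /=; apply/andP; split.
    have /row_fullP[B Bp] := fp; apply/row_fullP; exists (B *m p0.1).
    by rewrite -mulmxA redAG.
  (* [pi] kills the first [a] generators of the target, hence their images under [G]; this forces
     the upper right block to vanish modulo [pi]. *)
  have TX : T (pi *: (row_mx 1%:M 0 : 'M[o]_(a, a + b)) *m G).
    rewrite /G mulmxA; apply: (@lat_mul _ _ _ _ _ _ A); first by rewrite latE.
    rewrite -mulmxA YA mulmxDr mulmx1 -scalemxAr; apply: rtsD; last exact: rts_pi2.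
    split=> i j; rewrite mxE ?row_mxEr ?mxE ?mulr0; last exact: pideal0.
    by rewrite mulrC; apply: pidealMl; apply/pidealP; exists 1; rewrite mulr1.
  rewrite -scalemxAl -[G]vsubmxK mul_row_col mul1mx mul0mx addr0 in TX.
  apply/eqP/matrixP => i j; case: TX => _ /(_ i j); rewrite !mxE => /pidealP[y].
  by rewrite expr2 -mulrA => /(mulfI pi_neq0) ->; rewrite rmorphM red_pi mul0r.
rewrite /f; split.
  have := gA; rewrite inE => /andP[/row_fullP[C Cg] _].
  have /row_fullP[B Bp] := f0; apply/row_fullP; exists (C *m B).
  by rewrite /= map_mxM !map_red_lift -mulmxA (mulmxA B) Bp mul1mx.
apply/asboolP; rewrite (lat_congr (mx_key_liftK _)).
by apply/seteqP; split=> v; rewrite /lat /= mulmxA; move=> /(rts_aut _ gA).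
Qed.

Hypothesis sec0 : sec 0 = 0.

Lemma mx_key0 n : mx_key (0 : 'M[o]_(n, a + b)) = (0, 0).
Proof.
have dv0 : dv 0 = 0.
  have := dvE 0; rewrite rmorph0 sec0 add0r => /esym/eqP.
  by rewrite mulf_eq0 (negbTE pi_neq0) => /eqP.
by congr pair; apply/matrixP => i j; rewrite !mxE /= ?dv0 rmorph0.
Qed.

Lemma rts_lift n (p : 'M[F]_(n, a + b) * 'M[F]_(n, b)) : T (mx_lift p) <-> p = (0, 0).
Proof.
rewrite -{1}(subr0 (mx_lift p)) mx_keyP mx_liftK mx_key0 //.
Qed.

Lemma rts_pi_lift n (p : 'M[F]_(n, a + b) * 'M[F]_(n, b)) :
  T (pi *: mx_lift p) <-> rsubmx p.1 = 0.
Proof.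
have E i j : pideal pi 2 (pi * mx_lift p i j) <-> p.1 i j = 0.
  have <- : red (mx_lift p i j) = p.1 i j.
    by have /matrixP/(_ i j) := map_red_lift p; rewrite mxE.
  rewrite redP; split=> /pidealP[y]; first last.
    by move=> ->; apply/pidealP; exists y; ring.
  by rewrite expr2 -mulrA => /(mulfI pi_neq0) ->; apply/pidealP; exists y.
split=> [[_ H]|/matrixP H].
  by apply/matrixP => i j; rewrite !mxE; apply/E; have := H i j; rewrite mxE.
split=> i j; rewrite mxE; last by apply/E; have := H i j; rewrite !mxE.
by apply/pidealP; exists (mx_lift p i (lshift b j)).
Qed.

Lemma row_lift n (p : 'M[F]_(n, a + b) * 'M[F]_(n, b)) i :
  row i (mx_lift p) = mx_lift (row i p.1, row i p.2).
Proof.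
apply/rowP => j; rewrite !mxE; congr (_ + _ * _).
by case: (fintype.split j) => k; rewrite !mxE.
Qed.

(** The annihilator exponent of the last row: [pi] kills a vector exactly when the leading digits of
    its last [b] coordinates vanish. *)
Definition key_order n (p : 'M[F]_(n.+1, a + b) * 'M[F]_(n.+1, b)) : nat :=
  if (row ord_max p.1 == 0) && (row ord_max p.2 == 0) then 0%N
  else if rsubmx (row ord_max p.1) == 0 then 1%N else 2%N.

Lemma lat_finite n (A : 'M[o]_(n, a + b)) : finite_set (cosets (lat pi A)).
Proof.
apply: (finite_cosets (f := fun v => mx_key (v *m A))); first exact: lat_submodule.
by move=> x y /mx_keyP; rewrite -mulmxBl.
Qed.

Lemma key_orderP n (p : 'M[F]_(n.+1, a + b) * 'M[F]_(n.+1, b)) x :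
  lat pi (mx_lift p) (x *: delta_mx 0 ord_max) <-> pideal pi (key_order p) x.
Proof.
rewrite /lat /= -scalemxAl -rowE row_lift; set r := mx_lift _.
have TZ c (v : 'rV[o]_(a + b)) : T v -> T (c *: v).
  by rewrite -mul_scalar_mx; apply: rtsM.
have Tr : T r <-> (row ord_max p.1 == 0) && (row ord_max p.2 == 0).
  by rewrite rts_lift; split=> [[-> ->]|/andP[/eqP -> /eqP ->]]; rewrite ?eqxx.
have Tpr : T (pi *: r) <-> rsubmx (row ord_max p.1) == 0.
  by rewrite rts_pi_lift; split=> /eqP.
(* A scalar that kills a nonzero vector is not a unit; using this twice extracts two factors
   [pi]. *)
have Tu c (v : 'rV[o]_(a + b)) : ~ T v -> T (c *: v) -> exists y, c = pi * y.
  move=> NT Tc; suff /redP/pidealP[y] : red c = 0 by rewrite expr1; exists y.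
  have [//|/red_unit uc] := eqVneq (red c) 0.
  by case: NT; rewrite -[v]scale1r -(mulVr uc) -scalerA; apply: TZ.
rewrite /key_order; case: ifP => [/Tr Hr|/negP NT].
  split=> _; last exact: TZ.
  by apply/pidealP; exists x; rewrite mul1r.
have {}NT : ~ T r by move/Tr.
case: ifP => [/Tpr Hr|/negP NTp].
  split=> [/(Tu _ _ NT)[y ->]|/pidealP[y ->]]; first by apply/pidealP; exists y.
  by rewrite expr1 mulrC -scalerA; apply: TZ.
have {}NTp : ~ T (pi *: r) by move/Tpr.
split=> [H|/pidealP[y ->]]; last by rewrite -scalerA; apply: rts_pi2.
have [y xE] := Tu _ _ NT H; move: H; rewrite xE mulrC -scalerA.
by move=> /(Tu _ _ NTp)[z ->]; apply/pidealP; exists z; ring.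
Qed.

Lemma delta_lat n (p : 'M[F]_(n.+1, a + b) * 'M[F]_(n.+1, b)) :
  delta #|F| (lat pi (mx_lift p)) ord_max = key_order p.
Proof.
set L := lat pi _; rewrite /delta.
have -> : proj_first (ltn_ord (ord_max : 'I_n.+1)) @` L = L.
  have E v : proj_first (ltn_ord (ord_max : 'I_n.+1)) v = v.
    by apply/rowP => j; rewrite mxE; congr (v _ _); apply: val_inj.
  by apply/seteqP; split=> [_ [v Lv <-]|v Lv]; [rewrite E|exists v; rewrite ?E].
rewrite (bool_irrelevance (ltnW _) (leqnSn n)).
have [sL fL] := (lat_submodule pi (mx_lift p), lat_finite (mx_lift p)).
have E := mod_index_proj sL fL (key_orderP p).
have L_gt0 : (0 < mod_index L)%N.
  by have [f _] := mod_index_map sL fL; apply: leq_ltn_trans (ltn_ord (f 0)).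
rewrite -/L in E; rewrite E trunc_log_mulX ?card_finNzRing_gt1 ?addKn //.
by move: L_gt0; rewrite E muln_gt0 => /andP[].
Qed.

(** * Specialisation of [omega] *)

Local Notation q := #|F|.
Local Notation Y := (q%:R : rat).

(** [A0], [A1] and [A2] count the keys of order at most 0, 1 and 2, so the coefficients are
    successive differences. *)
Lemma sum_key_order (n : nat) (u : rat) :
  let A0 := Y ^+ (n * b) * frames Y n (a + b) in
  let A1 := Y ^+ (n.+1 * b) * (frames Y n b * \prod_(i < a) (Y ^+ n.+1 - Y ^+ (b + i))) in
  let A2 := Y ^+ (n.+1 * b) * frames Y n.+1 (a + b) in
  \sum_(p in full_keys n.+1) u ^+ key_order p =
  A0 + u * (A1 - A0) + u ^+ 2 * (A2 - A1).
Proof.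
move=> A0 A1 A2; rewrite -[A0]card_full_keys_eq0 -[A1]card_full_keys_le1 -[A2]card_full_keys.
have E (S : {set 'M[F]_(n.+1, a + b) * 'M[F]_(n.+1, b)}) (P : pred _) :
    #|[set p in S | P p]%SET|%:R = \sum_(p in S) (P p)%:R :> rat.
  by rewrite -natr_sum -sum1dep_card big_mkcondr.
have E2 (S : {set 'M[F]_(n.+1, a + b) * 'M[F]_(n.+1, b)}) :
    #|S|%:R = \sum_(p in S) 1 :> rat by rewrite -sum1_card natr_sum.
rewrite !E E2 -!sumrB !mulr_sumr -!big_split; apply: eq_bigr => p _ /=.
rewrite /key_order; case: ifP => [/andP[/eqP p0 /eqP _]|_].
  have -> : rsubmx (row ord_max p.1) == 0.
    by rewrite p0; apply/eqP/matrixP => i j; rewrite !mxE.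
  by rewrite expr0 mulr1n; ring.
by case: eqP => _; rewrite ?expr1 ?mulr1n mulr0n; ring.
Qed.

Lemma psi_omega (n : nat) (l : int) :
  psi l q (omega pi q n.+1 a b) * #|aut_keys|%:R =
  \sum_(p in full_keys n.+1) (Y ^ (- l)) ^+ key_order p.
Proof.
pose L (p : 'M[F]_(n.+1, a + b) * 'M[F]_(n.+1, b)) := lat pi (mx_lift p).
pose S := full_keys n.+1.
(* On [S], [rep p] depends only on the lattice [L p], so its fixed points index the lattices; the
   default [p] is never reached there. *)
pose rep p := odflt p [pick p' in S | `[< L p' = L p >]].
have repP p : p \in S -> rep p \in S /\ L (rep p) = L p.
  move=> pS; rewrite /rep; case: pickP => [p' /andP[p'S /asboolP]//|/(_ p)].
  by rewrite pS /= asboolT.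
have rep_eq p p' : p \in S -> L p = L p' -> rep p = rep p'.
  move=> pS E; rewrite /rep; have -> : [pick x in S | `[< L x = L p >]] =
    [pick x in S | `[< L x = L p' >]] by rewrite E.
  by case: pickP => // /(_ p); rewrite pS /= asboolT.
have repS : {in S, forall p, rep (rep p) = rep p}.
  by move=> p pS; have [rS rL] := repP p pS; apply: rep_eq.
have latE : @lattices o pi n.+1 a b = (L @` [set` [set p in S | rep p == p]%SET])%classic.
  rewrite latticesE; apply/seteqP; split=> [_ [A fA <-]|_ [p + <-]].
    pose p := mx_key A.
    have pS : p \in S by rewrite inE.
    have [rS rL] := repP p pS; exists (rep p).
      by rewrite /= !inE repS // eqxx andbT; move: rS; rewrite inE.
    rewrite rL; apply/lat_congr.
    exact: mx_key_liftK.
  rewrite /= !inE => /andP[pS _]; exists (mx_lift p) => //=.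
  by rewrite map_red_lift.
rewrite /omega latE fsbig_image; last first.
  move=> p p'; rewrite !inE /= !inE => /andP[pS /eqP pE] /andP[p'S /eqP p'E] E.
  by rewrite -pE -p'E; apply: rep_eq; rewrite ?inE.
rewrite -(@bigfs _ _ _ _ (index_enum _)) ?index_enum_uniq //;
  last by move=> p _; rewrite mem_index_enum.
rewrite [psi _ _ _]raddf_sum mulr_suml /=.
rewrite [RHS](partition_big rep [pred p in S | rep p == p]) => [|p pS] /=; last first.
  by have [rS _] := repP p pS; rewrite rS repS ?eqxx.
have RE p : (p \in [set p in S | rep p == p]%SET) = (p \in S) && (rep p == p).
  by rewrite !inE.
apply: eq_big => [p|p]; first (rewrite -RE; reflexivity).
rewrite -[_ p]/(p \in [set p in S | rep p == p]%SET) RE => /andP[pS /eqP pE].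
rewrite [meval _ _]psi_delta delta_lat.
rewrite -(card_lat_fiber pS) -sum1_card natr_sum mulr_sumr.
rewrite [LHS](eq_bigl (fun p' => (p' \in S) && (rep p' == p))); last first.
  move=> p'; rewrite !inE; apply/andP/andP => -[p'S H]; split=> //.
    by rewrite -[X in _ == X]pE; apply/eqP/rep_eq; [rewrite inE|apply/asboolP].
  by apply/asboolP; move: H => /eqP <-; have [] := repP p' _; rewrite ?inE.
apply: eq_bigr => p' /andP[p'S /eqP p'p]; rewrite mulr1.
rewrite -!delta_lat.
by have [_ E] := repP p' p'S; rewrite -/(L p) -/(L p') -p'p E.
Qed.

Lemma psi_omegaE (n : nat) (l : int) : (a + b <= n.+1)%N ->
  let u := Y ^ (- l) in
  let p0 := Y ^- b * (Y ^+ (n.+1 - a - b) - 1) / (Y ^+ n.+1 - 1) in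
  let p2 := (Y ^+ n.+1 - Y ^+ n.+1 / Y ^+ b) / (Y ^+ n.+1 - 1) in
  psi l q (omega pi q n.+1 a b) =
  Y ^+ (b * (n.+1 - a - b)) * (qbinom Y n.+1 (a + b) * qbinom Y (a + b) a) *
    (p0 + u * (1 - p0 - p2) + u ^+ 2 * p2).
Proof.
move=> abn u p0 p2.
have [Y0 Y1] := (qbase_neq0 F, qbase_exp_neq1 F).
have G0 : #|aut_keys|%:R != 0 :> rat.
  rewrite card_aut_keys mulf_neq0 ?expf_neq0 // mulf_neq0 ?frames_self_neq0 //.
  have := frames_self_neq0 Y0 Y1 (a + b).
  by rewrite frames_split mulf_eq0 negb_or => /andP[].
apply: (mulIf G0); rewrite psi_omega sum_key_order frames_eq0 // frames_le1 //; last by lia.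
rewrite frames_qmulti // -card_aut_keys -/u -/p0 -/p2.
by ring.
Qed.

End Shape.
End Keys.

(** * Comparison with the Satake images *)

Theorem theorem3p6
  (n : nat) (hn : (1 <= n)%N) (k : nat) (hk : (k <= n)%N) (l : int)
  (o : idomainType) (ho : is_dvr o)
  (pi : o) (hpi : uniformizer pi) (hcompact : adic_compact pi)
  (F : finFieldType) (red : {rmorphism o -> F}) (hred : residue_map red)
  (q : nat) (hq : #|F| = q)
  (* the normalized Satake map, given by its values on the generators *)
  (Omega : {rmorphism hecke o n -> {mpoly rat[n.+1]}})
  (hOmega0 : Omega (hecke_T n pi 0) =
     'X_ord0 * \prod_(i < n) (1 + 'X_(lift ord0 i)))
  (hOmega : forall j : nat, (1 <= j <= n)%N ->
     Omega (hecke_T n pi j) =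
     'X_ord0 ^+ 2 * \sum_(j <= a < n.+1) \sum_(0 <= b < (n - a).+1)
       ((q ^ (b * (a + b + 1)))%N%:R : rat)
         *: (omega pi q n a b *+ card_sym F a (a - j))) :
  PhiC (q%:R : rat) n k l = psi l q (Omega (hecke_T n pi k)).
Proof.
have [red_surj red_ker] := hred.
have pi0 := uniformizer_neq0 ho hpi.
have redP x : red x = 0 <-> pideal pi 1 x by rewrite -hpi red_ker.
have red_unit x : red x != 0 -> x \is a GRing.unit.
  by move=> rx; apply/negPn/negP => /red_ker/eqP; rewrite (negbTE rx).
have [s sK] := choice red_surj.
(* Normalised at 0 so that the zero matrix has zero key. *)
pose sec u := if u == 0 then 0 else s u.
have sec0 : sec 0 = 0 by rewrite /sec eqxx.
have secK : cancel sec red.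
  by move=> u; rewrite /sec; case: eqP => [->|_]; rewrite ?rmorph0.
have [dv dvE] : exists dv : o -> o, forall x, x = sec (red x) + pi * dv x.
  have H x : exists y, x = sec (red x) + pi * y.
    have /redP/pidealP[y yE] : red (x - sec (red x)) = 0.
      by rewrite rmorphB secK subrr.
    by exists y; rewrite -[pi]expr1 -yE addrC subrK.
  by have [dv dvE] := choice H; exists dv.
rewrite -{}hq in hOmega *.
set Y : rat := #|F|%:R.
have [Y0 Y1] := (qbase_neq0 F, qbase_exp_neq1 F).
case: n hn hk Omega hOmega0 hOmega => // n _ hk Omega hOmega0 hOmega.
have [->|k0] := posnP k.
  rewrite hOmega0 /PhiC eqxx /psi mevalM mevalXU rmorph_prod big_ord_recr /=.
  (* For [k = 0] only the last variable is exceptional: q^l (1 + q^(n-l)) = q^l + q^n, with [n.+1]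
     in place of n here. *)
  transitivity (Y ^ l * (\prod_(i < n) (1 + Y ^+ i.+1) * (1 + Y ^ (n.+1%:Z - l)))).
    have -> : Y ^+ n.+1 = Y ^ l * Y ^ (n.+1%:Z - l).
      by rewrite -expfzDr // addrC subrK.
    by rewrite big_add1 big_mkord /=; ring.
  congr (_ * (_ * _)); last first.
    by rewrite mevalD meval1 mevalXU /= /bump leq0n add1n eqxx.
  apply: eq_bigr => i _.
  by rewrite mevalD meval1 mevalXU /= /bump leq0n add1n eqSS (ltn_eqF (ltn_ord i)).
rewrite hOmega ?k0 // /psi mevalM rmorphXn /= mevalXU /= rmorph_sum /=.
have -> : (Y ^ l) ^+ 2 = Y ^ (2 * l) by rewrite exprnP exprz_exp mulrC.
rewrite (PhiC_sum Y0 Y1 (S := card_sym_unit F)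
  (W := fun a b => psi l #|F| (omega pi #|F| n.+1 a b))) ?k0 ?hk //; first last.
- by move=> a b abn; exact: (psi_omegaE pi0 redP red_unit secK dvE sec0).
- exact: sum_qbinom_sym_unit.
- by rewrite gt_eqF // ltr_wpDl ?exprn_ge0 ?ler0n.
congr (_ * _); apply: eq_bigr => a _; rewrite rmorph_sum /=; apply: eq_bigr => b _.
by rewrite mevalZ mevalMn natrX -(card_sym_qbinom F (leq_subr k a)) mulr_natr.
Qed.
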